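(* Let $\mathcal{X}$ be a Finsler manifold which is not Riemannian, and suppose that a (path) isometric embedding $f : \mathcal{X} \to \mathbb{R}^{p,q}$ exists. Let $\pi^+$ and $\pi^-$ denote the natural projections from $\mathbb{R}^{p,q}$ onto $\mathbb{R}^{p,0}$ and $\mathbb{R}^{0,q}$, respectively. Then it must be the case that $p>0$, $q>0$, and both maps $\pi^+\circ f$ and $\pi^-\circ f$ are not locally Lipschitz (that is, neither of them is locally Lipschitz).
   Context: A Finsler manifold is a (connected) smooth manifold $\mathcal{X}$ with a norm $|\cdot|_x$ on each tangent space $T_x\mathcal{X}$, varying continuously with $x$. It carries the length metric $d$ in which $d(x,y)$ is the infimum of the lengths $\int |\alpha'(t)|\,dt$ of piecewise smooth paths from $x$ to $y$. It is Riemannian if each norm $|\cdot|_x$ is induced by an inner product on $T_x\mathcal{X}$. For integers $p,q\ge 0$, $\mathbb{R}^{p,q}$ denotes Minkowski space of signature $(p,q)$: the space $\mathbb{R}^p\times\mathbb{R}^q$ with the form $\langle x,y\rangle=\sum_{i=1}^p x_iy_i-\sum_{i=p+1}^{p+q}x_iy_i$. $\mathbb{R}^{p,0}$ and $\mathbb{R}^{0,q}$ denote its first $p$ and last $q$ coordinates. Energy: for a path $\alpha:[a,b]\to\mathcal{X}$, $E(\alpha)=\sup\sum_{k=1}^n \frac{d^2(\alpha(t_{k-1}),\alpha(t_k))}{t_k-t_{k-1}}$ over all subdivisions $a=t_0<\dots<t_n=b$. For a path $\beta:[a,b]\to\mathbb{R}^{p,q}$, $E(\beta)=\lim_{n\to\infty}\sum_{k=1}^n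 \frac{\langle \beta(t_k)-\beta(t_{k-1}),\,\beta(t_k)-\beta(t_{k-1})\rangle}{t_k-t_{k-1}}$, where $t_k=a+k\frac{b-a}{n}$, provided the limit exists. No finiteness of the energies of the components $\pi^+\circ\beta$ and $\pi^-\circ\beta$ is required. A (path) isometric embedding $f:\mathcal{X}\to\mathbb{R}^{p,q}$ is a topological embedding which preserves the energy of paths: for every Lipschitz path $\alpha$ in $\mathcal{X}$, $E(f\circ\alpha)$ is defined and $E(f\circ\alpha)=E(\alpha)$. A map is locally Lipschitz if every point has a neighborhood on which it is Lipschitz with respect to $d$ and the Euclidean distance on the target coordinates. *)

(* Defs.v *)
From HB Require Import structures.
From mathcomp Require Import all_boot all_order all_algebra.
From mathcomp Require Import all_classical all_reals all_analysis.

Set Implicit Arguments.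
Unset Strict Implicit.
Unset Printing Implicit Defensive.

Import Order.TTheory GRing.Theory Num.Theory.
Import numFieldNormedType.Exports.

Local Open Scope classical_set_scope.
Local Open Scope ring_scope.

(* [f] is of class C^k on [U]; only used with [U] open. *)
Fixpoint Ck_on (R : realType) (V W : normedModType R) (k : nat)
    (U : set V) (f : V -> W) : Prop :=
  match k with
  | 0 => forall x, U x -> {for x, continuous f}
  | k'.+1 => (forall x, U x -> differentiable f x) /\
             (forall v : V, Ck_on k' U (fun x => 'd f x v))
  end.

Definition smooth_on (R : realType) (V W : normedModType R)
    (U : set V) (f : V -> W) : Prop := forall k, Ck_on k U f.

(* A chart is a total function, meaningful only on its domain, and
   [chart_inv] is meaningful only on the image of that domain. *)
Record smooth_manifold (R : realType) (n : nat) := SmoothManifold {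
  carrier :> topologicalType;
  manifold_hausdorff : hausdorff_space carrier;
  manifold_second_countable : @second_countable carrier;
  manifold_connected : connected [set: carrier];
  chart_index : Type;
  chart_dom : chart_index -> set carrier;
  chart : chart_index -> carrier -> 'rV[R]_n;
  chart_inv : chart_index -> 'rV[R]_n -> carrier;
  chart_cover : forall x, exists i, chart_dom i x;
  chart_dom_open : forall i, open (chart_dom i);
  chart_img_open : forall i, open (chart i @` chart_dom i);
  chartK : forall i x, chart_dom i x -> chart_inv i (chart i x) = x;
  chart_continuous : forall i x, chart_dom i x -> {for x, continuous (chart i)};
  chart_inv_continuous : forall i y,
    (chart i @` chart_dom i) y -> {for y, continuous (chart_inv i)};
  transition_smooth : forall i j,
    smooth_on (chart i @` (chart_dom i `&` chart_dom j))
              (chart j \o chart_inv i) }.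

Definition chart_at (R : realType) (n : nat) (M : smooth_manifold R n)
    (x : M) : chart_index M :=
  projT1 (cid (chart_cover x)).

(* A tangent vector at [x] is given by its coordinates [v] in a chart [i]
   around [x]; coordinates in two charts represent the same vector when the
   differential of the transition map exchanges them.  Accordingly
   [fnorm i x v] is the norm of the vector of T_x M with coordinates [v] in
   the chart [i], and [fnorm_compat] says that it only depends on the vector.
   [fnorm_continuous] is continuity on the tangent bundle. *)
Record finsler_structure (R : realType) (n : nat) (M : smooth_manifold R n) :=
  FinslerStructure {
  fnorm : chart_index M -> M -> 'rV[R]_n -> R;
  fnorm_compat : forall i j x v, chart_dom i x -> chart_dom j x ->
    fnorm j x ('d (chart j \o chart_inv i) (chart i x) v) = fnorm i x v;
  fnorm_ge0 : forall i x v, chart_dom i x -> 0 <= fnorm i x v;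
  fnorm_eq0 : forall i x v, chart_dom i x -> fnorm i x v = 0 -> v = 0;
  fnormZ : forall i x (c : R) v, chart_dom i x ->
    fnorm i x (c *: v) = `|c| * fnorm i x v;
  fnormD : forall i x u v, chart_dom i x ->
    fnorm i x (u + v) <= fnorm i x u + fnorm i x v;
  fnorm_continuous : forall i x v, chart_dom i x ->
    {for (x, v), continuous (fun xv : M * 'rV[R]_n => fnorm i xv.1 xv.2)} }.

Record finsler_manifold (R : realType) (n : nat) := FinslerManifold {
  underlying :> smooth_manifold R n;
  finsler : finsler_structure underlying }.

Record inner_product (R : realType) (V : lmodType R) (g : V -> V -> R) :
    Prop := InnerProduct {
  inner_sym : forall u v, g u v = g v u;
  inner_linear : forall (c : R) u v w, g (c *: u + v) w = c * g u w + g v w;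
  inner_pos : forall u, u != 0 -> 0 < g u u }.

Definition riemannian (R : realType) (n : nat) (X : finsler_manifold R n) :
    Prop :=
  forall (i : chart_index X) (x : X), chart_dom i x ->
  exists2 g : 'rV[R]_n -> 'rV[R]_n -> R, inner_product g &
    forall v, fnorm (finsler X) i x v = Num.sqrt (g v v).

(* Paths on [a, b] are total functions on R, whose values outside [a, b] are
   irrelevant.  Smoothness on the closed interval [a, b] means that, in charts,
   the path locally extends to a smooth curve, also at the end points. *)
Definition smooth_path (R : realType) (n : nat) (M : smooth_manifold R n)
    (alpha : R -> M) (a b : R) : Prop :=
  forall t, t \in `[a, b] -> forall i, chart_dom i (alpha t) ->
  exists (U : set R) (c : R -> 'rV[R]_n),
    [/\ open U, U t, smooth_on U c &
        forall s, U s -> s \in `[a, b] ->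
          chart_dom i (alpha s) /\ chart i (alpha s) = c s].

Definition piecewise_smooth_path (R : realType) (n : nat)
    (M : smooth_manifold R n) (alpha : R -> M) (a b : R) : Prop :=
  exists2 s : seq R, itv_partition a b s &
    forall k, (k < size s)%N ->
      smooth_path alpha (nth b (a :: s) k) (nth b (a :: s) k.+1).

(* The derivative is a junk value at end points and break points, which form a
   finite set and do not affect the length. *)
Definition speed (R : realType) (n : nat) (X : finsler_manifold R n)
    (alpha : R -> X) (t : R) : R :=
  let i := chart_at (alpha t) in
  fnorm (finsler X) i (alpha t) (derive1 (chart i \o alpha) t).

Definition path_length (R : realType) (n : nat) (X : finsler_manifold R n)
    (alpha : R -> X) (a b : R) : R :=
  \int[@lebesgue_measure R]_(t in `[a, b]) speed alpha t.

(* The infimum is over a nonempty set of nonnegative reals, since a manifold is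
   connected by definition here. *)
Definition fdist (R : realType) (n : nat) (X : finsler_manifold R n)
    (x y : X) : R :=
  inf [set l | exists (a b : R) (alpha : R -> X),
    [/\ a < b, piecewise_smooth_path alpha a b, alpha a = x, alpha b = y &
        l = path_length alpha a b]].

Definition lipschitz_path (R : realType) (n : nat) (X : finsler_manifold R n)
    (alpha : R -> X) (a b : R) : Prop :=
  exists L : R, forall s t, s \in `[a, b] -> t \in `[a, b] ->
    fdist (alpha s) (alpha t) <= L * `|s - t|.

Definition energy (R : realType) (n : nat) (X : finsler_manifold R n)
    (alpha : R -> X) (a b : R) : \bar R :=
  ereal_sup [set e | exists2 s : seq R, itv_partition a b s &
    e = (\sum_(0 <= k < size s)
           let t0 := nth b (a :: s) k in let t1 := nth b (a :: s) k.+1 in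
           fdist (alpha t0) (alpha t1) ^+ 2 / (t1 - t0))%:E].

Definition minkowski_space (R : realType) (p q : nat) : Type :=
  ('rV[R]_p * 'rV[R]_q)%type.

HB.instance Definition _ (R : realType) (p q : nat) :=
  NormedModule.copy (minkowski_space R p q) ('rV[R]_p * 'rV[R]_q)%type.

Definition pi_plus (R : realType) (p q : nat) (x : minkowski_space R p q) : 'rV[R]_p :=
  x.1.

Definition pi_minus (R : realType) (p q : nat) (x : minkowski_space R p q) : 'rV[R]_q :=
  x.2.

Definition minkowski_form (R : realType) (p q : nat) (x y : minkowski_space R p q) : R :=
  \sum_(i < p) pi_plus x ord0 i * pi_plus y ord0 i
  - \sum_(i < q) pi_minus x ord0 i * pi_minus y ord0 i.

Definition minkowski_energy_sum (R : realType) (p q : nat)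
    (beta : R -> minkowski_space R p q) (a b : R) (m : nat) : R :=
  let t k := a + k%:R * ((b - a) / m%:R) in
  \sum_(1 <= k < m.+1)
    let d := beta (t k) - beta (t k.-1) in
    minkowski_form d d / (t k - t k.-1).

(* The energy of [beta] on [a, b] is defined and equal to [e]. *)
Definition has_minkowski_energy (R : realType) (p q : nat)
    (beta : R -> minkowski_space R p q) (a b : R) (e : R) : Prop :=
  minkowski_energy_sum beta a b @ \oo --> e.

Definition topological_embedding (S T : topologicalType) (f : S -> T) : Prop :=
  [/\ continuous f, injective f &
      forall U, open U -> exists2 V, open V & f @` U = V `&` range f].

Definition path_isometric_embedding (R : realType) (n p q : nat)
    (X : finsler_manifold R n) (f : X -> minkowski_space R p q) : Prop :=
  topological_embedding f /\
  forall (a b : R) (alpha : R -> X), a < b -> lipschitz_path alpha a b ->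
    exists2 e : R, has_minkowski_energy (f \o alpha) a b e &
      energy alpha a b = e%:E.

(* The norm of ['rV_m] in the library is the sup norm. *)
Definition euclidean_dist (R : realType) (m : nat) (x y : 'rV[R]_m) : R :=
  Num.sqrt (\sum_(i < m) (x ord0 i - y ord0 i) ^+ 2).

Definition locally_lipschitz (R : realType) (n m : nat)
    (X : finsler_manifold R n) (g : X -> 'rV[R]_m) : Prop :=
  forall x : X, exists2 U, nbhs x U & exists L : R,
    forall y z, U y -> U z -> euclidean_dist (g y) (g z) <= L * fdist y z.

(* Main.v *)
Require Import Defs.
From mathcomp Require Import all_boot all_order all_algebra.
From mathcomp Require Import all_classical all_reals all_analysis.
From mathcomp Require Import measurable_realfun ring lra.

Set Implicit Arguments.
Unset Strict Implicit.
Unset Printing Implicit Defensive.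

Import Order.TTheory GRing.Theory Num.Theory.
Import numFieldNormedType.Exports.

Local Open Scope classical_set_scope.
Local Open Scope ring_scope.

(* If one of the projections of [f] is locally Lipschitz, then so is the other, since
   the energy of the image of a segment (in a chart) is finite; if [p] or [q] is 0, one
   projection is constant.  It then suffices to show that every norm N of the Finsler
   structure satisfies a third difference identity,
     N(y+2z)^2 - 3 N(y+z)^2 + 3 N(y)^2 - N(y-z)^2 = 0,
   which makes k |-> N(y+kz)^2 quadratic and yields the parallelogram law.

   Let G(s,t) be the coordinates of [f] along the plane spanned by z and y, rescaled
   around a point.  Along the lines of slope k = -1, 0, 1, 2, i.e. t |-> (s+kt, t), the
   energy of G is close to N(y+kz)^2.  Energies over dyadic subdivisions of a single line
   are monotone for each coordinate of the Lipschitz map G, so the second differences of G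
   along lines are small in the mean.  Hence so are its second differences in s, and at
   small scales the increments of G in the directions (k,1) are affine in k up to a small
   error.  Their Minkowski squares are then quadratic in k, and averaging over s
   (by dominated convergence over the lines) gives the identity.  Averaging in this way
   replaces the differentiability of G almost everywhere. *)

(** * Parallelogram law *)

(** The obstacle is the indefinite form: a Minkowski energy sum is not monotone under refinement,
    and its limit does not control the two parts of the signature separately. With a Lipschitz
    bound, the dyadic energies of each single coordinate along a line form a bounded nondecreasing
    sequence. Its increments are sums of squared second differences, which therefore tend to 0. The
    same bound provides the dominating constants.

    Third differences annihilate quadratics and involve only the four directions (k, 1), all
    transverse to the s-axis, so that one average over s serves them all. The direction z itself is
    not measured: N(z)^2 is recovered from the growth of N(y + kz)^2 in k.

    Two errors remain. Near the base point the Finsler norm agrees with N only up to factors 1 - e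
    and 1 + e. And the four directions must start from common points, hence from rows t = jH,
    whereas the energies live on slanted lines; passing from one to the other costs a translation in
    s by at most a multiple of [del], the height of the strip. Both errors become negligible as e
    and [del] tend to 0. *)

Record is_norm (R : realType) (V : lmodType R) (N : V -> R) : Prop := IsNorm {
  norm_ge0 : forall v, 0 <= N v;
  norm_eq0 : forall v, N v = 0 -> v = 0;
  norm_scale : forall c v, N (c *: v) = `|c| * N v;
  norm_add : forall u v, N (u + v) <= N u + N v }.

Section is_norm_theory.
Variables (R : realType) (V : lmodType R) (N : V -> R).
Hypothesis Nn : is_norm N.

Lemma norm_zero : N 0 = 0.
Proof. by rewrite -(scale0r (0 : V)) (norm_scale Nn) normr0 mul0r. Qed.

Lemma norm_opp v : N (- v) = N v.
Proof. by rewrite -scaleN1r (norm_scale Nn) normrN normr1 mul1r. Qed.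

Lemma norm_dist u v : N (u - v) = N (v - u).
Proof. by rewrite -norm_opp opprB. Qed.

Lemma norm_gt0 v : v != 0 -> 0 < N v.
Proof.
move=> v0; rewrite lt_neqAle (norm_ge0 Nn) andbT eq_sym.
by apply: contra_neq v0; exact: (norm_eq0 Nn).
Qed.

Lemma norm_sub_le u v : `|N u - N v| <= N (u - v).
Proof.
have H a b : N a <= N b + N (a - b).
  by have := norm_add Nn b (a - b); rewrite addrC subrK.
have := H u v; have := H v u; rewrite (norm_dist v u) ler_norml; lra.
Qed.

End is_norm_theory.

Lemma bounded_multiples_eq0 (R : realType) (x C : R) :
  (forall k : nat, `|x| * k%:R <= C) -> x = 0.
Proof.
move=> H; apply/eqP/contraT; rewrite -normr_gt0 => x0.
have [k Hk] : exists k : nat, C / `|x| < k%:R.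
  by exists (Num.bound `|C / `|x| |); rewrite (le_lt_trans (ler_norm _))// archi_boundP.
by move: Hk; rewrite ltr_pdivrMr// mulrC ltNge H.
Qed.

Section third_difference.
Variables (R : realType) (V : lmodType R) (N : V -> R).
Hypothesis Nn : is_norm N.
Hypothesis third_diff : forall y z,
  N (y + z + z) ^+ 2 - 3 * N (y + z) ^+ 2 + 3 * N y ^+ 2 - N (y - z) ^+ 2 = 0.

(** The hypothesis is a recurrence of order three in k, so the induction carries three consecutive
    values. The right-hand sides interpolate the values at -1, 0, 1 by a quadratic. *)
Let norm_sqr_multiples y z (k : nat) :
  let B := (N (y + z) ^+ 2 - N (y - z) ^+ 2) / 2 in
  let C := (N (y + z) ^+ 2 + N (y - z) ^+ 2) / 2 - N y ^+ 2 in
  [/\ N (y + k%:R *: z - z) ^+ 2 = N y ^+ 2 + (k%:R - 1) * B + (k%:R - 1) ^+ 2 * C,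
      N (y + k%:R *: z) ^+ 2 = N y ^+ 2 + k%:R * B + k%:R ^+ 2 * C &
      N (y + k%:R *: z + z) ^+ 2 = N y ^+ 2 + (k%:R + 1) * B + (k%:R + 1) ^+ 2 * C].
Proof.
move=> B C; elim: k => [|k [H1 H2 H3]].
  by rewrite scale0r addr0 /B /C; split; field.
have E : y + k.+1%:R *: z = y + k%:R *: z + z.
  by rewrite -natr1 scalerDl scale1r addrA.
rewrite E addrK H2 H3 -natr1 addrK; split=> //.
have := third_diff (y + k%:R *: z) z; rewrite H1 H2 H3 => H.
apply/eqP; rewrite -subr_eq0 -H; apply/eqP; ring.
Qed.

(** By the triangle inequality N (y + kz) differs from k N z by at most N y, so its square is k^2
    N(z)^2 + O(k). Comparison with the quadratic of [norm_sqr_multiples] forces C = N(z)^2, which is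
    the claim. *)
Lemma parallelogram_of_third_difference y z :
  N (y + z) ^+ 2 + N (y - z) ^+ 2 = 2 * N y ^+ 2 + 2 * N z ^+ 2.
Proof.
pose B := (N (y + z) ^+ 2 - N (y - z) ^+ 2) / 2.
pose C := (N (y + z) ^+ 2 + N (y - z) ^+ 2) / 2 - N y ^+ 2.
suff : C - N z ^+ 2 = 0 by rewrite /C; lra.
have Nz := norm_ge0 Nn z; have Ny := norm_ge0 Nn y.
apply: (@bounded_multiples_eq0 _ _
  (2 * N z * N y + `|B| + N y ^+ 2 + N y ^+ 2 + `|C - N z ^+ 2|)) => k.
have [->|k0] := posnP k.
  by rewrite mulr0 !addr_ge0 ?mulr_ge0 ?sqr_ge0.
have k1 : 1 <= k%:R :> R by rewrite ler1n.
have [_ H _] := norm_sqr_multiples y z k; rewrite -/B -/C in H.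
have : `|N (y + k%:R *: z) - k%:R * N z| <= N y.
  have := norm_sub_le Nn (y + k%:R *: z) (k%:R *: z).
  by rewrite addrK (norm_scale Nn) normr_nat.
have M := norm_ge0 Nn (y + k%:R *: z).
set M' := N (y + _) in H M * => Hd.
have {Hd} : `|M' ^+ 2 - (k%:R * N z) ^+ 2| <= N y * (N y + 2 * (k%:R * N z)).
  rewrite subr_sqr normrM ler_pM// ger0_norm ?addr_ge0 ?mulr_ge0//.
  move: Hd; rewrite ler_norml; lra.
rewrite H => Hd.
rewrite -(ler_pM2r (lt_le_trans ltr01 k1)).
have -> : `|C - N z ^+ 2| * k%:R * k%:R = `|(C - N z ^+ 2) * k%:R ^+ 2|.
  by rewrite normrM (ger0_norm (sqr_ge0 _)); ring.
have -> : (C - N z ^+ 2) * k%:R ^+ 2 =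
  (N y ^+ 2 + k%:R * B + k%:R ^+ 2 * C - (k%:R * N z) ^+ 2) - (N y ^+ 2 + k%:R * B).
  by ring.
apply: (le_trans (ler_normB _ _)).
have := ler_normD (N y ^+ 2) (k%:R * B).
rewrite (normrM k%:R) normr_nat (ger0_norm (sqr_ge0 (N y))).
move: Hd; set X := `| _ - _|; set Y := `| _ + k%:R * B|.
have := normr_ge0 (C - N z ^+ 2); set c := `|C - _|; have := normr_ge0 B; set b := `|B|.
move=> b0 c0 h1 h2.
suff : N y * (N y + 2 * (k%:R * N z)) + (N y ^+ 2 + k%:R * b) <=
   (2 * N z * N y + b + N y ^+ 2 + N y ^+ 2 + c) * k%:R by lra.
have k0' : 0 <= k%:R - 1 :> R by rewrite subr_ge0.
have h3 := mulr_ge0 (sqr_ge0 (N y)) k0'.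
have h4 := mulr_ge0 c0 (ler0n R k).
move: h3 h4; clear; move: (k%:R : R) (N y) (N z) => kk ny nz h3 h4; nra.
Qed.

Let g (u v : V) : R := (N (u + v) ^+ 2 - N (u - v) ^+ 2) / 4.

Let gC u v : g u v = g v u.
Proof. by rewrite /g (addrC u) (norm_dist Nn). Qed.

Let par := parallelogram_of_third_difference.

Let gD u u' v : g (u + u') v = g u v + g u' v.
Proof.
(* Jordan and von Neumann: in h1 - h2 + h3 - h4 the squares in which u and u' have opposite signs
   cancel in pairs, because N is even. *)
have h1 := par (u + v) u'; have h2 := par (u - v) u'.
have h3 := par (u' + v) u; have h4 := par (u' - v) u.
have E1 : u + v + u' = u + u' + v by rewrite addrAC.
have E2 : u - v + u' = u + u' - v by rewrite addrAC.
have E3 : u' + v + u = u + u' + v by rewrite addrAC (addrC u').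
have E4 : u' - v + u = u + u' - v by rewrite addrAC (addrC u').
have E5 : N (u + v - u') = N (u' - v - u).
  by rewrite -(norm_opp Nn); congr N; rewrite opprB opprD addrA addrAC.
have E6 : N (u - v - u') = N (u' + v - u).
  by rewrite -(norm_opp Nn); congr N; rewrite opprB opprB addrA.
rewrite E1 E5 in h1; rewrite E2 E6 in h2; rewrite E3 in h3; rewrite E4 in h4.
rewrite /g; lra.
Qed.

Let gN u v : g (- u) v = - g u v.
Proof.
rewrite /g -(norm_opp Nn (- u + v)) -(norm_opp Nn (- u - v)) !opprD !opprK; lra.
Qed.

Let g0 v : g 0 v = 0.
Proof. by rewrite /g add0r sub0r (norm_opp Nn); lra. Qed.

Let gMn u v (k : nat) : g (k%:R *: u) v = k%:R * g u v.
Proof.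
elim: k => [|k IH]; first by rewrite scale0r g0 mul0r.
by rewrite -natr1 scalerDl scale1r gD IH mulrDl mul1r.
Qed.

Let g_bound u v : `|g u v| <= N u * (N u + N v).
Proof.
have h0 := norm_ge0 Nn u; have h1 := norm_ge0 Nn v.
have hp := norm_ge0 Nn (u + v); have hm := norm_ge0 Nn (u - v).
rewrite /g subr_sqr normrM normrV ?unitfE// normr_nat normrM.
rewrite (ger0_norm (addr_ge0 hp hm)).
have d : `|N (u + v) - N (u - v)| <= 2 * N u.
  rewrite (norm_dist Nn u v); apply: le_trans (norm_sub_le Nn _ _) _.
  rewrite opprB addrA addrAC addrK; apply: le_trans (norm_add Nn _ _) _; lra.
have s : N (u + v) + N (u - v) <= 2 * (N u + N v).
  have := norm_add Nn u v; have := norm_add Nn u (- v); rewrite (norm_opp Nn); lra.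
have := ler_pM (normr_ge0 _) (addr_ge0 hp hm) d s; lra.
Qed.

(* An additive function of a real variable that is bounded near 0 is linear. *)
Let gZ c u v : g (c *: u) v = c * g u v.
Proof.
pose m (t : R) := g (t *: u) v - t * g u v.
have mD s t : m (s + t) = m s + m t by rewrite /m scalerDl gD; ring.
have mN t : m (- t) = - m t by rewrite /m scaleNr gN; ring.
have mMn k t : m (k%:R * t) = k%:R * m t.
  by rewrite /m -scalerA gMn; ring.
have m1 : m 1 = 0 by rewrite /m scale1r; ring.
pose D := N u * (N u + N v) + `|g u v|.
have h0 := norm_ge0 Nn u; have h1 := norm_ge0 Nn v.
have mb t : 0 <= t -> t <= 1 -> `|m t| <= D.
  move=> t0 t1; rewrite /m; apply: le_trans (ler_normB _ _) _; apply: lerD.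
    apply: le_trans (g_bound _ _) _; rewrite (norm_scale Nn) ger0_norm//.
    have tu : t * N u <= N u by rewrite ler_piMl.
    by apply: ler_pM; rewrite ?mulr_ge0 ?addr_ge0 ?mulr_ge0 ?lerD2r.
  by rewrite normrM (ger0_norm t0) ler_piMl.
(* [m] is additive and vanishes at 1, so removing the integer part of t does not change its
   value. *)
have mb' t : 0 <= t -> `|m t| <= D.
  move=> t0; have [h1' h2'] := (truncn_le t, truncnS_gt t); rewrite t0 in h1'.
  set k := Num.trunc t in h1' h2'.
  have -> : t = (t - k%:R) + k%:R * 1 by rewrite mulr1 subrK.
  rewrite mD mMn m1 mulr0 addr0; apply: mb; first by rewrite subr_ge0.
  by rewrite lerBlDr addrC natr1 ltW.
suff mz t : 0 <= t -> m t = 0.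
  suff : m c = 0 by rewrite /m => /eqP; rewrite subr_eq0 => /eqP.
  have [c0|/ltW c0] := leP 0 c; first exact: mz.
  by rewrite -(opprK c) mN mz ?oppr0// oppr_ge0.
move=> t0; apply: (@bounded_multiples_eq0 _ _ D) => k.
rewrite mulrC -[k%:R]ger0_norm// -normrM -mMn; apply: mb'.
by rewrite mulr_ge0.
Qed.

Theorem inner_product_of_third_difference :
  exists2 h : V -> V -> R, inner_product h & forall v, N v = Num.sqrt (h v v).
Proof.
have gE v : g v v = N v ^+ 2.
  rewrite /g subrr (norm_zero Nn) -[v + v]mulr2n -scaler_nat (norm_scale Nn).
  by rewrite normr_nat; field.
exists g; last by move=> v; rewrite gE sqrtr_sqr ger0_norm ?(norm_ge0 Nn).
split=> // [c u v w|u u0]; first by rewrite gD gZ.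
by rewrite gE exprn_gt0// (norm_gt0 Nn).
Qed.

End third_difference.

(** * Averages over the unit interval *)

Section real_integral.
Variable R : realType.
Local Notation mu := (@lebesgue_measure R).
Implicit Types (f g : R -> R).

Lemma lipschitz_continuous f (M : R) :
  (forall s t, `|f s - f t| <= M * `|s - t|) -> continuous f.
Proof.
move=> H x; apply/cvgrPdist_lt => e e0.
have M0 : 0 < `|M| + 1 by rewrite ltr_pwDr.
near=> t; apply: le_lt_trans (H x t) _.
apply: (@le_lt_trans _ _ ((`|M| + 1) * `|x - t|)).
  by rewrite ler_wpM2r// (le_trans (ler_norm _))// lerDl.
rewrite mulrC -ltr_pdivlMr//.
near: t; exact: (nbhsx_ballx x (e / (`|M| + 1)) (divr_gt0 e0 M0)).
Unshelve. all: by end_near. Qed.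

Lemma continuous_integrable f (a b : R) :
  continuous f -> mu.-integrable `[a, b] (EFin \o f).
Proof.
move=> cf; apply: continuous_compact_integrable; first exact: segment_compact.
exact: continuous_subspaceT.
Qed.

Definition mean f : R := \int[mu]_(s in `[0, 1]) f s.

Let mI : measurable (`[0, 1]%classic : set R).
Proof. exact: measurable_itv. Qed.

Lemma mean_cst c : mean (fun=> c) = c.
Proof.
rewrite /mean Rintegral_cst//= lebesgue_measure_itv/= lte_fin ltr01 oppr0 adde0.
by rewrite mulr1.
Qed.

Lemma meanD f g : continuous f -> continuous g ->
  mean (fun s => f s + g s) = mean f + mean g.
Proof. by move=> cf cg; rewrite /mean RintegralD//; exact: continuous_integrable. Qed.

Lemma meanZ c f : continuous f -> mean (fun s => c * f s) = c * mean f.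
Proof. by move=> cf; rewrite /mean RintegralZl//; exact: continuous_integrable. Qed.

Lemma meanB f g : continuous f -> continuous g ->
  mean (fun s => f s - g s) = mean f - mean g.
Proof. by move=> cf cg; rewrite /mean RintegralB//; exact: continuous_integrable. Qed.

Lemma continuous_big_sum (J : Type) (r : seq J) (F : J -> R -> R) :
  (forall j, continuous (F j)) -> continuous (fun s => \sum_(j <- r) F j s).
Proof.
move=> cF; elim: r => [|j r IH].
  have -> : (fun s => \sum_(j <- [::]) F j s) = fun=> 0.
    by apply/funext => s; rewrite big_nil.
  by move=> x; exact: cvg_cst.
have -> : (fun s => \sum_(i <- j :: r) F i s) = fun s => F j s + \sum_(i <- r) F i s.
  by apply/funext => s; rewrite big_cons.
by move=> x; apply: cvgD; [exact: cF|exact: IH].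
Qed.

Lemma mean_sum (J : Type) (r : seq J) (F : J -> R -> R) :
  (forall j, continuous (F j)) ->
  mean (fun s => \sum_(j <- r) F j s) = \sum_(j <- r) mean (F j).
Proof.
move=> cF; elim: r => [|j r IH].
  rewrite big_nil -[RHS](mean_cst 0); congr mean.
  by apply/funext => s; rewrite big_nil.
rewrite big_cons -IH -(meanD (cF j) (continuous_big_sum (r := r) cF)).
by congr mean; apply/funext => s; rewrite big_cons.
Qed.

Lemma mean_le f g : continuous f -> continuous g ->
  (forall s, 0 <= s <= 1 -> f s <= g s) -> mean f <= mean g.
Proof.
move=> cf cg fg; by apply: le_Rintegral => //; exact: continuous_integrable.
Qed.

Lemma mean_norm f : continuous f -> `|mean f| <= mean (fun s => `|f s|).
Proof. by move=> cf; apply: le_normr_Rintegral => //; exact: continuous_integrable. Qed.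

Lemma continuous_norm f : continuous f -> continuous (fun s => `|f s|).
Proof. by move=> cf x; apply: cvg_norm; exact: cf. Qed.

Lemma continuous_translate f a : continuous f -> continuous (fun s => f (s + a)).
Proof.
by move=> cf x; apply: continuous_comp; [apply: cvgD; [exact: cvg_id|exact: cvg_cst]|exact: cf].
Qed.

(** The windows [tau, 1 + tau] and [0, 1] give integrals that differ by integrals over two intervals
    of length |tau|. This is the price of moving cells between slanted lines and rows. *)
Lemma mean_shift f (tau M : R) : continuous f -> (forall s, `|f s| <= M) ->
  `|mean (fun s => f (s + tau)) - mean f| <= 2 * `|tau| * M.
Proof.
(* The base point of the antiderivative lies strictly to the left of 0 and [tau], so that [F] is
   differentiable at every point used. *)
move=> cf bf; pose a := - (`|tau| + 1).
pose F := (fun z => \int[mu]_(t in `[a, z]) f t) : R -> R.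
have dF (x : R) : a < x -> derivable F x 1 /\ derive1 F x = f x.
  move=> ax; apply: (@continuous_FTC1_closed _ _ _ _ (x + 1)) => //.
  - by rewrite ltrDl.
  - exact: continuous_integrable.
  - exact: cf.
have cF : forall z : R, a < z -> {for z, continuous F}.
  by move=> z az; apply: differentiable_continuous; apply/derivable1_diffP; case: (dF z az).
have a0 : a < 0 by rewrite /a oppr_lt0 ltr_pwDr.
have aT : a < tau.
  by have := ler_norm (- tau); rewrite normrN /a; lra.
have main (b : R) : a < b -> mean (fun s => f (s + b)) = F (1 + b) - F b.
  move=> ab; rewrite /mean /Rintegral (@continuous_FTC2 _ _ (fun s => F (s + b)))//.
  - by rewrite add0r.
  - by apply: continuous_subspaceT; exact: continuous_translate.
  - have dG (x : R) : 0 <= x -> is_derive x 1 (fun s => F (s + b)) (f (x + b)).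
      move=> x0; have [] := dF (x + b); first by apply: (lt_le_trans ab); rewrite lerDr; lra.
      move=> d1 d2; have := @is_derive1_comp _ F (fun s => s + b) x (f (x + b)) 1.
      rewrite mulr1; apply.
        by split; [exact: d1|rewrite -derive1E].
      exact: is_derive_shift.
    have cG : forall x : R, 0 <= x -> {for x, continuous (fun s => F (s + b))}.
      move=> x /dG d; apply: differentiable_continuous; apply/derivable1_diffP.
      exact: ex_derive.
    split.
    + by move=> x; rewrite in_itv/= => /andP[/ltW/dG d _]; exact: ex_derive.
    + exact/cvg_at_right_filter/cG.
    + exact/cvg_at_left_filter/cG.
  - move=> x; rewrite in_itv/= => /andP[x0 _].
    have [] := dF (x + b); first by apply: (lt_le_trans ab); rewrite lerDr; lra.
    move=> d1 d2; rewrite derive1E; have := @is_derive1_comp _ F (fun s => s + b) x (f (x + b)) 1.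
    rewrite mulr1 => H; apply: derive_val; apply: H.
      by split; [exact: d1|rewrite -derive1E].
    exact: is_derive_shift.
have -> : mean f = mean (fun s => f (s + 0)) by congr mean; apply/funext => s; rewrite addr0.
rewrite !main// addr0.
have lipF (x y : R) : a < x -> x <= y -> `|F y - F x| <= M * (y - x).
  move=> ax; rewrite le_eqVlt => /predU1P[->|xy]; first by rewrite !subrr normr0 mulr0.
  have [||c _ ->] := @MVT _ F f x y xy.
  - move=> z; rewrite in_itv/= => /andP[xz _]; have [] := dF z; first exact: lt_trans xz.
    by move=> d1 d2; split; [exact: d1|rewrite -derive1E].
  - apply: continuous_in_subspaceT => z; rewrite inE/= in_itv/= => /andP[xz _].
    by apply: cF; exact: lt_le_trans xz.
  by rewrite normrM ler_pM// ger0_norm// subr_ge0 ltW.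
have lipF' (x y : R) : a < x -> a < y -> `|F y - F x| <= M * `|y - x|.
  move=> ax ay; have [xy|/ltW yx] := leP x y.
    by rewrite (ger0_norm (_ : 0 <= y - x)) ?subr_ge0//; exact: lipF.
  by rewrite distrC (distrC y) (ger0_norm (_ : 0 <= x - y)) ?subr_ge0//; exact: lipF.
have h1 := lipF' 1 (1 + tau) ltac:(lra) ltac:(lra).
have h2 := lipF' 0 tau ltac:(lra) ltac:(lra).
have -> : F (1 + tau) - F tau - (F 1 - F 0) = (F (1 + tau) - F 1) - (F tau - F 0) by ring.
apply: (le_trans (ler_normB _ _)).
move: h1 h2; rewrite [1 + tau]addrC addrK subr0; lra.
Qed.

Lemma mean_bounded_cvg0 (f : nat -> R -> R) (M : R) :
  (forall n, continuous (f n)) -> (forall n s, 0 <= f n s <= M) ->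
  (forall s, 0 <= s <= 1 -> f n s @[n --> \oo] --> 0) ->
  mean (f n) @[n --> \oo] --> 0.
Proof.
move=> cf bf cvf.
have [] := @dominated_convergence _ (measurableTypeR R) R mu `[0, 1]%classic mI
  (fun n => EFin \o f n) (fun=> 0%:E) (fun=> M%:E).
- by move=> n; apply: (measurable_int mu); exact: continuous_integrable.
- exact: measurable_cst.
- apply: aeW => s /=; rewrite in_itv/= => s01.
  by apply: cvg_EFin; [exact: nearW|exact: cvf].
- by have := @continuous_integrable (fun=> M) 0 1; apply => x; exact: cvg_cst.
- by apply: aeW => s n _ /=; rewrite lee_fin; have /andP[h0 hM] := bf n s; rewrite ger0_norm.
move=> _ _; rewrite integral0 => H.
have H2 := fine_cvg H. exact: H2.
Qed.

(* Dominated convergence is applied to the excess [max (|f n - c| - eta) 0], whose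
   limit is 0, so that nothing has to be known about [g]. *)
Lemma mean_bounded_cvg (f : nat -> R -> R) (g : R -> R) (M c eta : R) :
  (forall n, continuous (f n)) -> (forall n s, `|f n s| <= M) ->
  (forall s, 0 <= s <= 1 -> f n s @[n --> \oo] --> g s) ->
  (forall s, 0 <= s <= 1 -> `|g s - c| <= eta) ->
  forall e, 0 < e -> \forall n \near \oo, `|mean (f n) - c| <= eta + e.
Proof.
move=> cf bf cvf gc e e0.
pose psi n s := Num.max (`|f n s - c| - eta) 0.
have eta0 : 0 <= eta.
  by apply: le_trans (gc 0 _); rewrite ?lexx ?ler01.
have cmx : continuous (fun y : R => Num.max (`|y - c| - eta) 0).
  apply: (@lipschitz_continuous _ 1) => y z; rewrite mul1r.
  have h1 := ler_distD z y c; have h2 := ler_distD y z c; rewrite (distrC z y) in h2.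
  have h3 := normr_ge0 (y - z); rewrite ler_norml.
  by case: (leP (`|y - c| - eta) 0) => h4; case: (leP (`|z - c| - eta) 0) => h5;
    apply/andP; split; lra.
have cpsi n : continuous (psi n).
  by move=> x; exact: (continuous_comp (@cf n x) (@cmx (f n x))).
have cpsi0 (s : R) : 0 <= s <= 1 -> psi n s @[n --> \oo] --> 0.
  move=> s01; have E : Num.max (`|g s - c| - eta) 0 = 0 by rewrite max_r// subr_le0 gc.
  by have := cvg_comp _ _ (cvf s s01) (@cmx (g s)); rewrite E.
have M0 : 0 <= M by apply: le_trans (bf 0%N 0).
have bpsi n s : 0 <= psi n s <= M + `|c|.
  rewrite /psi le_max lexx orbT/= ge_max addr_ge0// andbT.
  have := ler_normB (f n s) c; have := bf n s; lra.
have /cvgrPdist_le/(_ e e0) := mean_bounded_cvg0 cpsi bpsi cpsi0.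
apply: filterS => n; rewrite sub0r normrN => Hn.
have ccst (d : R) : continuous (fun _ : R => d) by move=> x; exact: cvg_cst.
have cfc : continuous (fun s => f n s - c).
  by move=> x; exact: (cvgB (@cf n x) (ccst c x)).
have -> : mean (f n) - c = mean (fun s => f n s - c).
  by rewrite (meanB (cf n) (ccst c)) mean_cst.
apply: le_trans (mean_norm cfc) _.
apply: (@le_trans _ _ (mean (fun s => eta + psi n s))).
  apply: mean_le; [exact: continuous_norm| |].
    by move=> x; exact: (cvgD (ccst eta x) (@cpsi n x)).
  by move=> s _; rewrite /psi -lerBlDl le_max lexx.
rewrite (meanD (ccst eta) (@cpsi n)) mean_cst lerD2l.
exact: le_trans (ler_norm _) Hn.
Qed.

End real_integral.

(** * Energies of lines in the plane *)

Lemma big_ord_pairs (V : nmodType) (F : nat -> V) m :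
  \sum_(j < 2 * m) F j = \sum_(j < m) (F (2 * j)%N + F (2 * j).+1).
Proof.
elim: m => [|m IH]; first by rewrite muln0 !big_ord0.
by rewrite mulnS add2n !big_ord_recr/= IH addrA.
Qed.

Section second_differences.
Variables (R : realType) (gam : R -> R) (M del : R).
Hypothesis gam_lip : forall s t, `|gam s - gam t| <= M * `|s - t|.
Hypothesis del0 : 0 < del.

Let H K := del / 2 ^+ K.

Let H0 K : 0 < H K. Proof. by rewrite divr_gt0// exprn_gt0. Qed.

Let HS K : H K.+1 = H K / 2.
Proof. by rewrite /H exprS invfM mulrCA mulrC. Qed.

Let sumH K : \sum_(j < 2 ^ K) H K = del.
Proof.
by rewrite sumr_const card_ord -mulr_natr natrX /H divfK// expf_neq0.
Qed.

Let A K := \sum_(j < 2 ^ K) (gam (j%:R * H K + H K) - gam (j%:R * H K)) ^+ 2 / H K.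

Let bend K (j : nat) :=
  gam (j%:R * H K + H K) - 2 * gam (j%:R * H K + H K / 2) + gam (j%:R * H K).

(** With increments a and b over the two halves of a cell, 2 a^2 + 2 b^2 - (a + b)^2 = (a - b)^2.
    Refinement thus increases the energy by exactly the squared second differences. *)
Let A_step K : A K.+1 - A K = \sum_(j < 2 ^ K) bend K j ^+ 2 / H K.
Proof.
rewrite /A expnS (big_ord_pairs
  (fun j => (gam (j%:R * H K.+1 + H K.+1) - gam (j%:R * H K.+1)) ^+ 2 / H K.+1)).
rewrite -sumrB; apply: eq_bigr => j _; rewrite HS.
have e1 : (2 * j)%N%:R * (H K / 2) = j%:R * H K by rewrite natrM; field.
have e2 : (2 * j).+1%:R * (H K / 2) = j%:R * H K + H K / 2.
  by rewrite -natr1 natrM; field.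
have e3 : j%:R * H K + H K / 2 + H K / 2 = j%:R * H K + H K by field.
rewrite e1 e2 e3 /bend; field; exact: lt0r_neq0.
Qed.

Let A_cvg : cvg (A @ \oo).
Proof.
apply: nondecreasing_is_cvgn.
  apply/nondecreasing_seqP => K; rewrite -subr_ge0 A_step sumr_ge0// => j _.
  by rewrite divr_ge0 ?sqr_ge0// ltW.
exists (M ^+ 2 * del) => _ [K _ <-].
rewrite -(sumH K) mulr_sumr; apply: ler_sum => j _.
have := gam_lip (j%:R * H K + H K) (j%:R * H K).
rewrite [X in M * `|X|]addrC addKr (ger0_norm (ltW (H0 K))) => h.
rewrite ler_pdivrMr// -real_normK ?num_real//.
have := ler_pM (normr_ge0 _) (normr_ge0 _) h h; rewrite -!expr2; lra.
Qed.

(** [A] is nondecreasing and bounded, so the sums in [A_step] tend to 0. The cells have total length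
    [del], which lets a bound on the sum of squares divided by H control the sum of absolute
    values. *)
Lemma second_differences_cvg0 :
  \sum_(j < 2 ^ K) `|bend K j| @[K --> \oo] --> 0.
Proof.
have cA : A K.+1 - A K @[K --> \oo] --> 0.
  rewrite -(subrr (lim (A @ \oo))); apply: cvgB => //.
  by rewrite (cvg_shiftS A).
apply/cvgrPdist_le => e e0.
pose eta := e / del; have eta0 : 0 < eta by rewrite divr_gt0.
have /cvgrPdist_le/(_ _ (mulr_gt0 eta0 e0)) := cA.
apply: filterS => K; rewrite !sub0r !normrN => hK.
rewrite ger0_norm; last by apply: sumr_ge0 => j _.
(* |b| <= b^2 / (2 eta H) + eta H / 2 by the arithmetic-geometric mean inequality; with eta = e /
   del the last terms add up to e / 2. *)
apply: (@le_trans _ _ (\sum_(j < 2 ^ K) (bend K j ^+ 2 / H K / (2 * eta) + eta / 2 * H K))).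
  apply: ler_sum => j _.
  have := sqr_ge0 (`|bend K j| - eta * H K); rewrite sqrrB real_normK ?num_real// => h.
  have -> : bend K j ^+ 2 / H K / (2 * eta) + eta / 2 * H K =
    (bend K j ^+ 2 + (eta * H K) ^+ 2) / (2 * (eta * H K)).
    by field; rewrite !lt0r_neq0.
  rewrite ler_pdivlMr; last by apply: mulr_gt0 => //; exact: (mulr_gt0 eta0 (H0 K)).
  move: h; rewrite -mulr_natr; lra.
rewrite big_split/= -mulr_sumr sumH -mulr_suml -A_step.
have -> : eta / 2 * del = e / 2 by rewrite /eta; field; rewrite lt0r_neq0.
have : (A K.+1 - A K) / (2 * eta) <= e / 2.
  have := le_trans (ler_norm _) hK.
  by rewrite ler_pdivrMr; [lra|exact: mulr_gt0].
lra.
Qed.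

End second_differences.

Lemma cvg_sum0 (R : realType) (J : Type) (r : seq J) (u : J -> nat -> R) :
  (forall j, u j n @[n --> \oo] --> 0) -> \sum_(j <- r) u j n @[n --> \oo] --> 0.
Proof.
move=> cu; elim: r => [|j r IH].
  by under eq_fun do rewrite big_nil; exact: cvg_cst.
under eq_fun do rewrite big_cons.
by have := cvgD (cu j) IH; rewrite addr0; exact.
Qed.

(** The coefficients 1, 3, 3, 1 add up to 8. *)
Lemma third_difference_close (R : realType) (x2 x1 x0 xm y2 y1 y0 ym a T : R) :
  `|x2 - y2| <= a -> `|x1 - y1| <= a -> `|x0 - y0| <= a -> `|xm - ym| <= a ->
  `|x2 - 3 * x1 + 3 * x0 - xm| <= T -> `|y2 - 3 * y1 + 3 * y0 - ym| <= T + 8 * a.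
Proof.
rewrite !ler_norml => /andP[? ?] /andP[? ?] /andP[? ?] /andP[? ?] /andP[? ?].
by apply/andP; split; lra.
Qed.

(** * Third differences of energies for a Lipschitz map of the plane *)

Section lipschitz_plane_map.
Variables (R : realType) (I : finType) (sgn : I -> R) (G : I -> R -> R -> R) (L : R).
Hypothesis sgn1 : forall l, `|sgn l| <= 1.
Hypothesis L0 : 0 <= L.
Hypothesis G_lip : forall l s t s' t',
  `|G l s t - G l s' t'| <= L * (`|s - s'| + `|t - t'|).

Definition diag_form (d : I -> R) : R := \sum_l sgn l * d l ^+ 2.

Let D k H t s l := G l (s + k * H) (t + H) - G l s t.
Let B k H t s l :=
  G l (s + k * H) (t + H) - 2 * G l (s + k * (H / 2)) (t + H / 2) + G l s t.

Let D_bound k H t s l : 0 <= H -> `|k| <= 2 -> `|D k H t s l| <= 3 * L * H.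
Proof.
move=> H0 k2; apply: le_trans (G_lip _ _ _ _ _) _.
rewrite [s + _]addrC addrK [t + _]addrC addrK normrM (ger0_norm H0).
have := ler_wpM2r (mulr_ge0 H0 L0) k2; lra.
Qed.

Let B_bound k H t s l : 0 <= H -> `|k| <= 2 -> `|B k H t s l| <= 3 * L * H.
Proof.
move=> H0 k2.
have e1 := G_lip l (s + k * H) (t + H) (s + k * (H / 2)) (t + H / 2).
have e2 := G_lip l (s + k * (H / 2)) (t + H / 2) s t.
have h2 : 0 <= H / 2 by rewrite divr_ge0.
have e3 : s + k * H - (s + k * (H / 2)) = k * (H / 2) by field.
have e4 : t + H - (t + H / 2) = H / 2 by field.
rewrite e3 e4 normrM (ger0_norm h2) in e1.
have e5 : s + k * (H / 2) - s = k * (H / 2) by ring.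
have e6 : t + H / 2 - t = H / 2 by ring.
rewrite e5 e6 normrM (ger0_norm h2) in e2.
have -> : B k H t s l = (G l (s + k * H) (t + H) - G l (s + k * (H / 2)) (t + H / 2)) -
  (G l (s + k * (H / 2)) (t + H / 2) - G l s t) by rewrite /B; ring.
apply: le_trans (ler_normB _ _) _.
have := ler_wpM2r (mulr_ge0 h2 L0) k2; lra.
Qed.

(* Second differences in [s] alone are combinations of second differences along
   lines of slopes -1, 0, 1, 2.  The latter are controlled by the energies of
   single lines, while the rows [t = j H] vary with [H]. *)
Let row_bend H t s l :
  D 2 H t s l - 2 * D 1 H t s l + D 0 H t s l =
  B 2 H t s l - B 1 H t s l + B (-1) H t (s + H) l - B 0 H t (s + H) l.
Proof.
rewrite /D /B.
have -> : s + H + -1 * H = s by ring.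
have -> : s + H + -1 * (H / 2) = s + H / 2 by field.
have -> : s + H + 0 * H = s + H by ring.
have -> : s + H + 0 * (H / 2) = s + H by ring.
have -> : s + 2 * (H / 2) = s + H by field.
have -> : s + 1 * H = s + H by ring.
have -> : s + 1 * (H / 2) = s + H / 2 by ring.
have -> : s + 0 * H = s by ring.
ring.
Qed.

(** The terms produced by [row_bend] at [s] and at [s - H]. Together they measure how far the
    increments for k = -1, 0, 1, 2 are from being affine in k. *)
Let bends H t s l := `|B 2 H t s l| + `|B 1 H t s l| +
  `|B (-1) H t (s + H) l| + `|B 0 H t (s + H) l| +
  `|B 2 H t (s - H) l| + `|B 1 H t (s - H) l| + `|B (-1) H t s l| + `|B 0 H t s l|.

Let cell_bound H t s l : 0 <= H ->
  `|D 2 H t s l ^+ 2 - 3 * D 1 H t s l ^+ 2 + 3 * D 0 H t s l ^+ 2 - D (-1) H t s l ^+ 2|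
  <= 12 * L * H * bends H t s l.
Proof.
move=> H0.
have n2 : `|2| <= 2 :> R by rewrite normr_nat.
have n1 : `|1| <= 2 :> R by rewrite normr1 ler1n.
have nm : `|-1| <= 2 :> R by rewrite normrN1 ler1n.
have n0 : `|0 : R| <= 2 by rewrite normr0 ler0n.
have h2 := D_bound t s l H0 n2; have h1 := D_bound t s l H0 n1.
have h0 := D_bound t s l H0 n0; have hm := D_bound t s l H0 nm.
have r1 := row_bend H t s l; have r0 := row_bend H t (s - H) l.
rewrite subrK in r0.
(* Moving the base point back by H lowers each slope by 1; the values at the base point cancel,
   since 1 - 2 + 1 = 0. *)
have E : D 2 H t (s - H) l - 2 * D 1 H t (s - H) l + D 0 H t (s - H) l =
  D 1 H t s l - 2 * D 0 H t s l + D (-1) H t s l.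
  rewrite /D.
  have -> : s - H + 2 * H = s + 1 * H by ring.
  have -> : s - H + 1 * H = s + 0 * H by ring.
  have -> : s - H + 0 * H = s + -1 * H by ring.
  ring.
rewrite E in r0; rewrite /bends.
move: r1 r0 h2 h1 h0 hm.
move: (D 2 H t s l) (D 1 H t s l) (D 0 H t s l) (D (-1) H t s l) => x2 x1 x0 xm.
move: (B 2 H t s l) (B 1 H t s l) (B (-1) H t (s + H) l) (B 0 H t (s + H) l)
  (B 2 H t (s - H) l) (B 1 H t (s - H) l) (B (-1) H t s l) (B 0 H t s l).
move=> b1 b2 b3 b4 b5 b6 b7 b8 r1 r0 h2 h1 h0 hm.
(* Each outer increment is compared with its affine extrapolation: the right-hand side is (x2^2 - (2
   x1 - x0)^2) - (xm^2 - (2 x0 - x1)^2), with both differences of squares factored. *)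
have -> : x2 ^+ 2 - 3 * x1 ^+ 2 + 3 * x0 ^+ 2 - xm ^+ 2 =
  (b1 - b2 + b3 - b4) * (x2 + 2 * x1 - x0) - (b5 - b6 + b7 - b8) * (xm + 2 * x0 - x1).
  by rewrite -r1 -r0; ring.
have T (a b c d : R) : `|a - b + c - d| <= `|a| + `|b| + `|c| + `|d|.
  apply: le_trans (ler_normB _ _) _; rewrite lerD2r.
  apply: le_trans (ler_normD _ _) _; rewrite lerD2r; exact: ler_normB.
have U (a b c : R) : `|a| <= 3 * L * H -> `|b| <= 3 * L * H -> `|c| <= 3 * L * H ->
  `|a + 2 * b - c| <= 12 * L * H.
  move=> ha hb hc; apply: le_trans (ler_normB _ _) _.
  have := ler_normD a (2 * b); rewrite normrM normr_nat; lra.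
apply: le_trans (ler_normB _ _) _; rewrite !normrM.
have := ler_pM (normr_ge0 _) (normr_ge0 _) (T b1 b2 b3 b4) (U _ _ _ h2 h1 h0).
have := ler_pM (normr_ge0 _) (normr_ge0 _) (T b5 b6 b7 b8) (U _ _ _ hm h0 h1).
lra.
Qed.

Let G_cont l a b t : continuous (fun s => G l (s + a + b) t).
Proof.
apply: (@lipschitz_continuous _ _ L) => s s'.
apply: le_trans (G_lip _ _ _ _ _) _; rewrite subrr normr0 addr0.
by rewrite (_ : s + a + b - (s' + a + b) = s - s')//; ring.
Qed.

Let G_cont1 l a t : continuous (fun s => G l (s + a) t).
Proof.
apply: (@lipschitz_continuous _ _ L) => s s'.
apply: le_trans (G_lip _ _ _ _ _) _; rewrite subrr normr0 addr0.
by rewrite (_ : s + a - (s' + a) = s - s')//; ring.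
Qed.

Let D_cont k H t a l : continuous (fun s => D k H t (s + a) l).
Proof. by move=> s; apply: cvgB; [exact: G_cont|exact: G_cont1]. Qed.

Let B_cont k H t a l : continuous (fun s => B k H t (s + a) l).
Proof.
move=> s; apply: cvgD; last exact: G_cont1.
apply: cvgB; first exact: G_cont.
by apply: cvgMr; exact: G_cont.
Qed.

Let absB_cont k H t a l : continuous (fun s => `|B k H t (s + a) l|).
Proof. exact: continuous_norm (@B_cont k H t a l). Qed.

Let diag_form_cont k H t a : continuous (fun s => diag_form (D k H t (s + a))).
Proof.
apply: (@continuous_big_sum _ _ _ (fun l s => sgn l * D k H t (s + a) l ^+ 2)) => l s.
by apply: cvgMr; rewrite expr2; apply: cvgM; exact: D_cont.
Qed.

Let diag_form_cont0 k H t : continuous (fun s => diag_form (D k H t s)).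
Proof.
rewrite (_ : (fun s => _) = fun s => diag_form (D k H t (s + 0))); first exact: diag_form_cont.
by apply/funext => s; rewrite addr0.
Qed.

Let diag_form_bound k H t s : 0 <= H -> `|k| <= 2 ->
  `|diag_form (D k H t s)| <= #|I|%:R * (3 * L * H) ^+ 2.
Proof.
move=> H0 k2; apply: le_trans (ler_norm_sum _ _ _) _.
rewrite [leRHS]mulr_natl -sumr_const; apply: ler_sum => l _.
rewrite normrM normrX -[leRHS]mul1r ler_pM//.
have := D_bound t s l H0 k2 => h.
have := ler_pM (normr_ge0 _) (normr_ge0 _) h h; by rewrite -!expr2.
Qed.

Variable del : R.
Hypothesis del0 : 0 < del.
Let H K := del / 2 ^+ K.

(* The energy sum of [t |-> G (s + k t, t)] on [0, del], for the uniform
   subdivision into [2 ^ K] intervals. *)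
Definition line_energy k K s : R := \sum_(j < 2 ^ K)
  diag_form (fun l => G l (s + k * (j%:R * H K) + k * H K) (j%:R * H K + H K)
                 - G l (s + k * (j%:R * H K)) (j%:R * H K)) / H K.

Let H0 K : 0 < H K. Proof. by rewrite divr_gt0// exprn_gt0. Qed.

Let sumH K : \sum_(j < 2 ^ K) H K = del.
Proof.
by rewrite sumr_const card_ord -mulr_natr natrX /H divfK// expf_neq0.
Qed.

Let HK K : (2 ^ K)%:R * H K = del.
Proof. by rewrite -(sumH K) sumr_const card_ord mulr_natl. Qed.

Let jH K (j : 'I_(2 ^ K)) : 0 <= j%:R * H K <= del.
Proof.
have h := ltW (H0 K); apply/andP; split; first by rewrite mulr_ge0.
by rewrite -(HK K) ler_wpM2r// ler_nat ltnW.
Qed.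

Let HK_le K : H K <= del.
Proof. by rewrite -(HK K) ler_peMl ?(ltW (H0 K))// ler1n expn_gt0. Qed.

(** In each row the cells for all k start at the same point (s, jH), as [cell_bound] requires, while
    those of [line_energy] start at (s + k jH, jH). *)
Let row_energy k K := \sum_(j < 2 ^ K) mean (fun s => diag_form (D k (H K) (j%:R * H K) s)) / H K.

Let line_energyE k K :
  mean (line_energy k K) = \sum_(j < 2 ^ K)
    mean (fun s => diag_form (D k (H K) (j%:R * H K) (s + k * (j%:R * H K)))) / H K.
Proof.
rewrite /line_energy (@mean_sum _ _ _ (fun (j : 'I_(2 ^ K)) s =>
  diag_form (D k (H K) (j%:R * H K) (s + k * (j%:R * H K))) / H K)).
  apply: eq_bigr => j _; rewrite [RHS]mulrC -(meanZ _ (@diag_form_cont _ _ _ _)).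
  by congr mean; apply/funext => s; rewrite mulrC.
by move=> j s; apply: cvgMl; exact: diag_form_cont.
Qed.

(** Row j is translated by k jH, at most 2 del in absolute value, and the integrand is at most #|I|
    (3 L H)^2; hence 36 = 2 . 2 . 9 in [mean_shift]. *)
Let line_row k K : `|k| <= 2 ->
  `|mean (line_energy k K) - row_energy k K| <= 36 * #|I|%:R * L ^+ 2 * del ^+ 2.
Proof.
move=> k2; rewrite line_energyE -sumrB; apply: le_trans (ler_norm_sum _ _ _) _.
have -> : 36 * #|I|%:R * L ^+ 2 * del ^+ 2 =
  \sum_(j < 2 ^ K) 36 * #|I|%:R * L ^+ 2 * del * H K.
  by rewrite -mulr_sumr sumH; ring.
apply: ler_sum => j _; rewrite -mulrBl normrM normfV (ger0_norm (ltW (H0 K))).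
rewrite ler_pdivrMr//.
have c := @diag_form_cont0 k (H K) (j%:R * H K).
apply: le_trans (mean_shift _ c (fun s => diag_form_bound _ s (ltW (H0 K)) k2)) _.
have /andP[j0 j1] := jH j.
have : `|k * (j%:R * H K)| <= 2 * del.
  by rewrite normrM ler_pM// ger0_norm.
have X0 : 0 <= #|I|%:R * (3 * L * H K) ^+ 2 by rewrite mulr_ge0// sqr_ge0.
move=> /(ler_wpM2r X0); lra.
Qed.

Let W k K := mean (fun s => \sum_l \sum_(j < 2 ^ K)
  `|B k (H K) (j%:R * H K) (s + k * (j%:R * H K)) l|).

(** For fixed [s] the cells lie on one line for every K, so [second_differences_cvg0] applies to a
    fixed function of one variable; dominated convergence passes to the mean. *)
Let W_cvg0 k : `|k| <= 2 -> W k K @[K --> \oo] --> 0.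
Proof.
move=> k2; apply: (@mean_bounded_cvg0 _ _ (#|I|%:R * (3 * L * del))) => [K|K s|s _].
- apply: (@continuous_big_sum _ _ _ (fun l s => \sum_(j < 2 ^ K)
    `|B k (H K) (j%:R * H K) (s + k * (j%:R * H K)) l|)) => l.
  apply: (@continuous_big_sum _ _ _ (fun (j : 'I_(2 ^ K)) s =>
    `|B k (H K) (j%:R * H K) (s + k * (j%:R * H K)) l|)) => j.
  exact: absB_cont.
- rewrite sumr_ge0 => [|l _]; last by rewrite sumr_ge0.
  rewrite /= [leRHS]mulr_natl -sumr_const; apply: ler_sum => l _.
  rewrite -(sumH K) mulr_sumr; apply: ler_sum => j _.
  exact: B_bound (ltW (H0 K)) k2.
- apply: cvg_sum0 => l.
  have lip u v : `|G l (s + k * u) u - G l (s + k * v) v| <= 3 * L * `|u - v|.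
    apply: le_trans (G_lip _ _ _ _ _) _.
    have -> : s + k * u - (s + k * v) = k * (u - v) by ring.
    rewrite normrM; have := ler_wpM2r (mulr_ge0 (normr_ge0 (u - v)) L0) k2; lra.
  pose gam u := G l (s + k * u) u.
  have E K : \sum_(j < 2 ^ K) `|B k (H K) (j%:R * H K) (s + k * (j%:R * H K)) l| =
    \sum_(j < 2 ^ K) `|gam (j%:R * H K + H K) - 2 * gam (j%:R * H K + H K / 2)
      + gam (j%:R * H K)|.
    by apply: eq_bigr => j _; rewrite /B /gam !mulrDr !addrA.
  under eq_fun do rewrite E.
  exact: (@second_differences_cvg0 _ gam _ _ lip del0).
Qed.

(** The transfer from lines back to rows, with the displacements 0, H, -H that occur in [bends]. The
    translation is at most 3 del, and 18 = 2 . 3 . 3. *)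
Let B_rows k K tau : `|k| <= 2 -> `|tau| <= H K ->
  \sum_(j < 2 ^ K) mean (fun s => \sum_l `|B k (H K) (j%:R * H K) (s + tau) l|) <=
  W k K + 18 * #|I|%:R * L * del ^+ 2.
Proof.
move=> k2 tauH.
have cB t a : continuous (fun s => \sum_l `|B k (H K) t (s + a) l|).
  apply: (@continuous_big_sum _ _ _ (fun l s => `|B k (H K) t (s + a) l|)) => l.
  exact: absB_cont.
have -> : W k K = \sum_(j < 2 ^ K)
  mean (fun s => \sum_l `|B k (H K) (j%:R * H K) (s + k * (j%:R * H K)) l|).
  rewrite -mean_sum; last by move=> j; exact: cB.
  by congr mean; apply/funext => s; rewrite exchange_big.
have -> : 18 * #|I|%:R * L * del ^+ 2 = \sum_(j < 2 ^ K) (18 * #|I|%:R * L * del) * H K.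
  by rewrite -mulr_sumr sumH; ring.
rewrite -big_split/=; apply: ler_sum => j _.
have bB s : `|\sum_l `|B k (H K) (j%:R * H K) (s + k * (j%:R * H K)) l| |
    <= #|I|%:R * (3 * L * H K).
  apply: le_trans (ler_norm_sum _ _ _) _; rewrite [leRHS]mulr_natl -sumr_const.
  by apply: ler_sum => l _; rewrite normr_id; exact: B_bound (ltW (H0 K)) k2.
have := mean_shift (tau - k * (j%:R * H K)) (@cB _ (k * (j%:R * H K))) bB.
have -> : (fun s => \sum_l `|B k (H K) (j%:R * H K)
    (s + (tau - k * (j%:R * H K)) + k * (j%:R * H K)) l|) =
  (fun s => \sum_l `|B k (H K) (j%:R * H K) (s + tau) l|).
  by apply/funext => s; apply: eq_bigr => l _; rewrite -addrA subrK.
have /andP[j0 j1] := jH j.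
have : `|tau - k * (j%:R * H K)| <= 3 * del.
  apply: le_trans (ler_normB _ _) _; rewrite normrM (ger0_norm j0).
  have := ler_pM (normr_ge0 _) j0 k2 j1; have := HK_le K; lra.
have X0 : 0 <= #|I|%:R * (3 * L * H K) by rewrite !mulr_ge0// ltW.
move=> /(ler_wpM2r X0) h1 /(le_trans (ler_norm _)); lra.
Qed.

(** [cell_bound], averaged over s and summed over the rows; its factor H cancels the division by H
    in the energies. Each slope occurs in two of the eight terms of [bends], and each term costs one
    error from [B_rows]. *)
Let row_energy_third_difference K :
  `|row_energy 2 K - 3 * row_energy 1 K + 3 * row_energy 0 K - row_energy (-1) K| <=
  12 * L * (2 * (W 2 K + W 1 K + W 0 K + W (-1) K) + 8 * (18 * #|I|%:R * L * del ^+ 2)).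
Proof.
have cF k t : continuous (fun s => diag_form (D k (H K) t s)) by exact: diag_form_cont0.
have cF' a k t : continuous (fun s => a * diag_form (D k (H K) t s)).
  by move=> s; apply: cvgMr; exact: cF.
have cB k t a : continuous (fun s => \sum_l `|B k (H K) t (s + a) l|).
  apply: (@continuous_big_sum _ _ _ (fun l s => `|B k (H K) t (s + a) l|)) => l.
  exact: absB_cont.
pose S k a t := mean (fun s => \sum_l `|B k (H K) t (s + a) l|).
apply: (@le_trans _ _ (12 * L * \sum_(j < 2 ^ K) (
  S 2 0 (j%:R * H K) + S 1 0 (j%:R * H K) + S (-1) (H K) (j%:R * H K) + S 0 (H K) (j%:R * H K) +
  S 2 (- H K) (j%:R * H K) + S 1 (- H K) (j%:R * H K) + S (-1) 0 (j%:R * H K)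
    + S 0 0 (j%:R * H K)))); last first.
  rewrite ler_wpM2l ?mulr_ge0// !big_split/=.
  have n2 : `|2| <= 2 :> R by rewrite normr_nat.
  have n1 : `|1| <= 2 :> R by rewrite normr1 ler1n.
  have nm : `|-1| <= 2 :> R by rewrite normrN1 ler1n.
  have n0 : `|0 : R| <= 2 by rewrite normr0 ler0n.
  have t0 : `|0 : R| <= H K by rewrite normr0 (ltW (H0 K)).
  have t1 : `|H K| <= H K by rewrite (ger0_norm (ltW (H0 K))).
  have tm : `|- H K| <= H K by rewrite normrN (ger0_norm (ltW (H0 K))).
  have := B_rows n2 t0; have := B_rows n1 t0; have := B_rows nm t0; have := B_rows n0 t0.
  have := B_rows nm t1; have := B_rows n0 t1; have := B_rows n2 tm; have := B_rows n1 tm.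
  rewrite /S; lra.
rewrite /row_energy !mulr_sumr -sumrB -big_split/= -sumrB.
apply: le_trans (ler_norm_sum _ _ _) _; apply: ler_sum => j _.
set t := j%:R * H K.
have -> : mean (fun s => diag_form (D 2 (H K) t s)) / H K -
    3 * (mean (fun s => diag_form (D 1 (H K) t s)) / H K) +
    3 * (mean (fun s => diag_form (D 0 (H K) t s)) / H K) -
    mean (fun s => diag_form (D (-1) (H K) t s)) / H K =
  mean (fun s => diag_form (D 2 (H K) t s) - 3 * diag_form (D 1 (H K) t s)
    + 3 * diag_form (D 0 (H K) t s) - diag_form (D (-1) (H K) t s)) / H K.
  rewrite meanB//; last first.
    by move=> s; apply: cvgD; [apply: cvgB; [exact: cF|exact: cF']|exact: cF'].
  rewrite meanD//; last by move=> s; apply: cvgB; [exact: cF|exact: cF'].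
  by rewrite meanB// !meanZ//; field; exact: lt0r_neq0.
rewrite normrM normfV (ger0_norm (ltW (H0 K))) ler_pdivrMr//.
have cT : continuous (fun s => diag_form (D 2 (H K) t s) - 3 * diag_form (D 1 (H K) t s)
    + 3 * diag_form (D 0 (H K) t s) - diag_form (D (-1) (H K) t s)).
  move=> s; apply: cvgB; last exact: cF.
  by apply: cvgD; [apply: cvgB; [exact: cF|exact: cF']|exact: cF'].
apply: le_trans (mean_norm cT) _.
(* Slopes and displacements of the eight terms of [bends], in the same order. *)
pose r := [:: (2, 0); (1, 0); (-1, H K); (0, H K); (2, - H K); (1, - H K); (-1, 0);
  (0 : R, 0 : R)].
pose g s := \sum_(x <- r) \sum_l `|B x.1 (H K) t (s + x.2) l|.
have cg : continuous g by apply: continuous_big_sum => x; exact: cB.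
rewrite [leRHS](_ : _ = mean (fun s => 12 * L * H K * g s)); last first.
  rewrite (meanZ _ cg) /g mean_sum => [|x]; last exact: cB.
  by rewrite !big_cons big_nil /S/=; ring.
apply: mean_le => [||s _]; first exact: continuous_norm cT.
  by move=> s; apply: cvgMr; exact: cg.
have -> : g s = \sum_l bends (H K) t s l.
  rewrite /g exchange_big; apply: eq_bigr => l _.
  by rewrite !big_cons big_nil /bends/= !addr0 !addrA.
rewrite /diag_form/= !mulr_sumr -sumrB -big_split/= -sumrB.
apply: le_trans (ler_norm_sum _ _ _) _; apply: ler_sum => l _.
have h := cell_bound t s l (ltW (H0 K)).
apply: le_trans h.
rewrite [leLHS](_ : _ = `|sgn l| * `|D 2 (H K) t s l ^+ 2 - 3 * D 1 (H K) t s l ^+ 2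
    + 3 * D 0 (H K) t s l ^+ 2 - D (-1) (H K) t s l ^+ 2|).
  by rewrite ler_piMl.
by rewrite -normrM; congr `|_|; ring.
Qed.

(** The constant collects the errors of the two transfers: 2016 = 8 . 36 + 12 . 8 . 18, from
    [line_row] and from [B_rows]. *)
Lemma third_difference_bound (c : R -> R) (eps : R) :
  (forall k s, k \in [:: 2; 1; 0; -1] -> 0 <= s <= 1 ->
    exists2 e, line_energy k K s @[K --> \oo] --> e & `|e - c k * del| <= eps * del) ->
  `|c 2 - 3 * c 1 + 3 * c 0 - c (-1)| <= 8 * eps + 2016 * #|I|%:R * L ^+ 2 * del.
Proof.
move=> hc.
have k2 (k : R) : k \in [:: 2; 1; 0; -1] -> `|k| <= 2.
  by rewrite !inE => /or4P[] /eqP ->; rewrite ?normrN ?normr0 ?normr1 ?normr_nat ?ler1n ?ler0n.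
have lc k K : continuous (line_energy k K).
  apply: (@continuous_big_sum _ _ _ (fun (j : 'I_(2 ^ K)) s =>
    diag_form (D k (H K) (j%:R * H K) (s + k * (j%:R * H K))) / H K)) => j s.
  by apply: cvgMl; exact: diag_form_cont.
have lb k K s : `|k| <= 2 -> `|line_energy k K s| <= 9 * #|I|%:R * L ^+ 2 * del.
  move=> kk; apply: le_trans (ler_norm_sum _ _ _) _.
  rewrite -(sumH K) mulr_sumr; apply: ler_sum => j _.
  rewrite normrM normfV (ger0_norm (ltW (H0 K))) ler_pdivrMr//.
  by apply: le_trans (diag_form_bound _ _ (ltW (H0 K)) kk) _; lra.
have near_mean (k e : R) : k \in [:: 2; 1; 0; -1] -> 0 < e ->
    \forall K \near \oo, `|mean (line_energy k K) - c k * del| <= eps * del + e.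
  move=> kin e0.
  pose g s := lim (line_energy k K s @[K --> \oo]).
  apply: (@mean_bounded_cvg _ _ g (9 * #|I|%:R * L ^+ 2 * del)) => //.
  - by move=> K s; apply: lb; exact: k2.
  - by move=> s s01; have [l hl _] := hc k s kin s01; apply/cvg_ex; exists l.
  - move=> s s01; have [l hl hle] := hc k s kin s01.
    by rewrite /g (cvg_lim _ hl).
have near_W (k e : R) : k \in [:: 2; 1; 0; -1] -> 0 < e -> \forall K \near \oo, W k K <= e.
  move=> kin e0; have /cvgrPdist_le/(_ e e0) := W_cvg0 (k2 k kin).
  apply: filterS => K; rewrite sub0r normrN; exact: le_trans (ler_norm _).
(* [e] accounts for stopping at a finite K: weight 8 for the four mean energies, and 12 L . 2 . 4
   for the four terms W. *)
have key e : 0 < e -> `|c 2 - 3 * c 1 + 3 * c 0 - c (-1)| * del <=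
    (8 * eps + 2016 * #|I|%:R * L ^+ 2 * del) * del + (8 + 96 * L) * e.
  move=> e0.
  have i2 : 2 \in [:: 2; 1; 0; -1 : R] by rewrite !inE eqxx.
  have i1 : 1 \in [:: 2; 1; 0; -1 : R] by rewrite !inE eqxx ?orbT.
  have i0 : 0 \in [:: 2; 1; 0; -1 : R] by rewrite !inE eqxx ?orbT.
  have im : -1 \in [:: 2; 1; 0; -1 : R] by rewrite !inE eqxx ?orbT.
  near \oo => K.
  have m2 : `|mean (line_energy 2 K) - c 2 * del| <= eps * del + e by near: K; exact: near_mean.
  have m1 : `|mean (line_energy 1 K) - c 1 * del| <= eps * del + e by near: K; exact: near_mean.
  have m0 : `|mean (line_energy 0 K) - c 0 * del| <= eps * del + e by near: K; exact: near_mean.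
  have mm : `|mean (line_energy (-1) K) - c (-1) * del| <= eps * del + e
    by near: K; exact: near_mean.
  have w2 : W 2 K <= e by near: K; exact: near_W.
  have w1 : W 1 K <= e by near: K; exact: near_W.
  have w0 : W 0 K <= e by near: K; exact: near_W.
  have wm : W (-1) K <= e by near: K; exact: near_W.
  have r2 := line_row K (k2 _ i2); have r1 := line_row K (k2 _ i1).
  have r0 := line_row K (k2 _ i0); have rm := line_row K (k2 _ im).
  have T := row_energy_third_difference K.
  have LW : L * (W 2 K + W 1 K + W 0 K + W (-1) K) <= L * (4 * e).
    rewrite ler_wpM2l// (_ : 4 * e = e + e + e + e); last by ring.
    by rewrite !lerD.
  have rc (x y z a b : R) : `|y - x| <= a -> `|y - z| <= b -> `|x - z| <= b + a.
    by move=> h1 h2; apply: le_trans (ler_distD y x z) _; rewrite addrC lerD// distrC.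
  have := third_difference_close (rc _ _ _ _ _ r2 m2) (rc _ _ _ _ _ r1 m1)
    (rc _ _ _ _ _ r0 m0) (rc _ _ _ _ _ rm mm) T.
  have -> : c 2 * del - 3 * (c 1 * del) + 3 * (c 0 * del) - c (-1) * del =
    (c 2 - 3 * c 1 + 3 * c 0 - c (-1)) * del by ring.
  rewrite normrM (ger0_norm (ltW del0)) => /le_trans; apply.
  rewrite [leRHS](_ : _ = 24 * (L * (4 * e)) + 1728 * #|I|%:R * L ^+ 2 * del ^+ 2 +
    8 * (eps * del + e + 36 * #|I|%:R * L ^+ 2 * del ^+ 2)); last by ring.
  rewrite lerD2r mulrDr lerD//; last by rewrite le_eqVlt; apply/orP; left; apply/eqP; ring.
  rewrite [leLHS](_ : _ = 24 * (L * (W 2 K + W 1 K + W 0 K + W (-1) K))); last by ring.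
  by rewrite ler_pM2l.
rewrite -(ler_pM2r del0); apply/ler_addgt0Pr => e e0.
have L8 : 0 < 8 + 96 * L by rewrite ltr_wpDr ?mulr_ge0.
have := key (e / (8 + 96 * L)) (divr_gt0 e0 L8).
by rewrite (mulrC (8 + 96 * L)) divfK// lt0r_neq0.
Unshelve. all: by end_near. Qed.

End lipschitz_plane_map.

(** * Lengths of paths *)

Section dini.
Variable R : realType.
Local Notation mu := (@lebesgue_measure R).

(** A minimum of v t - 2 eta t on [p, q] can only be at q: to the right of any earlier point this
    function takes smaller values. *)
Lemma dini_le (v : R -> R) (p q : R) : p <= q -> {within `[p, q], continuous v} ->
  (forall t, p <= t < q -> forall e, 0 < e ->
     \forall t' \near t^'+, v t' - v t <= e * (t' - t)) ->
  v q <= v p.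
Proof.
move=> pq cv dv; apply/ler_addgt0Pr => e e0.
pose eta := e / (2 * (q - p + 1)).
have qp0 : 0 < q - p + 1 by rewrite ltr_pwDr// subr_ge0.
have eta0 : 0 < eta by rewrite divr_gt0// mulr_gt0.
have [|c] := @EVT_min R (fun t => v t - 2 * eta * t) p q pq.
  move=> x; apply: cvgB; first exact: cv.
  by move: x; apply: continuous_subspaceT; exact: mulrl_continuous.
rewrite in_itv/= => /andP[pc cq] cmin.
have cqE : c = q.
  apply/eqP; rewrite eq_le cq/= leNgt; apply/negP => cltq.
  have H := dv c (introT andP (conj pc cltq)) eta eta0.
  near c^'+ => t'.
  have h1 : v t' - v c <= eta * (t' - c) by near: t'.
  have h2 : c < t' by [].
  have h3 : t' < q by near: t'; exact: nbhs_right_lt.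
  have := cmin t'; rewrite in_itv/= (le_trans pc (ltW h2)) (ltW h3) => /(_ isT).
  have : 0 < eta * (t' - c) by rewrite mulr_gt0// subr_gt0.
  lra.
have := cmin p; rewrite in_itv/= lexx pq cqE => /(_ isT).
have : 2 * eta * (q - p + 1) = e by rewrite /eta; field; exact: lt0r_neq0.
lra.
Unshelve. all: by end_near. Qed.

(** Used for u = Phi along a path, which need not be differentiable; only an upper bound on its
    right difference quotients is known, so the fundamental theorem of calculus is applied to
    neither side. *)
Lemma le_integral_of_dini (u s : R -> R) (p q : R) : p < q ->
  {within `[p, q], continuous u} -> {within `[p, q], continuous s} ->
  (forall t, p <= t < q -> forall e, 0 < e ->
     \forall t' \near t^'+, u t' - u t <= (s t + e) * (t' - t)) ->
  u q - u p <= \int[mu]_(t in `[p, q]) s t.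
Proof.
move=> pq cu cs du.
have is_ : mu.-integrable `[p, q] (EFin \o s).
  by apply: continuous_compact_integrable => //; exact: segment_compact.
pose S t := \int[mu]_(x in `[p, t]) s x.
have Sp : S p = 0 by rewrite /S set_itv1 Rintegral_set1.
have cS : {within `[p, q], continuous S}.
  by apply: parameterized_integral_continuous => //; exact: ltW.
suff : u q - S q <= u p - S p by rewrite Sp -/(S q); lra.
apply: (@dini_le (fun t => u t - S t)) (ltW pq) _ _.
  by move=> x; apply: cvgB; [exact: cu|exact: cS].
move=> t /andP[pt tq] e e0.
have e20 : 0 < e / 2 by rewrite divr_gt0.
have H := du t (introT andP (conj pt tq)) _ e20.
have cvs : s x @[x --> t^'+] --> s t.
  have [_ sp _] := (continuous_within_itvP s pq).1 cs.
  move: pt; rewrite le_eqVlt => /predU1P[<-//|pt].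
  have [+ _ _] := (continuous_within_itvP s pq).1 cs.
  move=> /(_ t); rewrite in_itv/= pt tq => /(_ isT) ct.
  exact: cvg_at_right_filter.
have /cvgrPdist_le/(_ _ e20) := cvs; rewrite near_withinE => -[d /= d0 Hd].
near=> t'.
have tt' : t < t' by near: t'; exact: nbhs_right_gt.
have h1 : u t' - u t <= (s t + e / 2) * (t' - t) by near: t'.
have t'q : t' < q by near: t'; exact: nbhs_right_lt.
have t'd : t' < t + d by near: t'; apply: nbhs_right_lt; rewrite ltrDl.
have is' : mu.-integrable `[p, t'] (EFin \o s).
  by apply: integrableS is_ => //; apply: subset_itvl; rewrite bnd_simp ltW.
have is'' : mu.-integrable `]t, t'] (EFin \o s).
  by apply: integrableS is' => //; apply: subset_itvr; rewrite bnd_simp.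
have SS : S t' - S t = \int[mu]_(x in `]t, t']) s x.
  by rewrite /S Rintegral_itvB// bnd_simp// ltW.
have icst : mu.-integrable `]t, t'] (EFin \o cst (s t - e / 2)).
  apply: (@integrableS _ _ _ mu `[t, t']) => //.
    exact: subset_itv_oc_cc.
  apply: continuous_compact_integrable; first exact: segment_compact.
  by apply: continuous_subspaceT => x; exact: cvg_cst.
have : (s t - e / 2) * (t' - t) <= S t' - S t.
  rewrite SS.
  have -> : (s t - e / 2) * (t' - t) = \int[mu]_(x in `]t, t']) (cst (s t - e / 2) x).
    rewrite Rintegral_cst//= lebesgue_measure_itv/= lte_fin tt'.
    by rewrite -EFinD.
  apply: le_Rintegral => // x /=; rewrite in_itv/= => /andP[tx xt'].
  have K : `|s t - s x| <= e / 2.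
    apply: Hd => //=; rewrite distrC ger0_norm ?subr_ge0 ?(ltW tx)//.
    by rewrite ltrBlDl; exact: le_lt_trans t'd.
  by move: K; rewrite ler_norml => /andP[_]; rewrite /=; lra.
lra.
Unshelve. all: by end_near. Qed.

End dini.

Section difference_quotients.
Variables (R : realType) (V : normedModType R).
Implicit Types (c d : R -> V).

Lemma difference_quotient_cvg c (t : R) : differentiable c t ->
  h^-1 *: (c (h + t) - c t) @[h --> 0^'] --> derive1 c t.
Proof.
move=> /derivable1_diffP; rewrite /derivable /derive1.
have -> : (fun h : R => h^-1 *: ((c \o shift t) (h *: 1) - c t)) =
   (fun h : R => h^-1 *: (c (h + t) - c t)).
  by apply/funext => h /=; rewrite /shift/= [h *: 1]mulr1.
done.
Qed.

(** At an end point the functions agree on one side only, but a one-sided limit of difference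
    quotients already determines the derivative of a differentiable function. *)
Lemma derive1_eq_on_segment c d (p q t : R) (U : set R) : p < q -> p <= t <= q ->
  open U -> U t -> differentiable c t -> differentiable d t ->
  (forall s, U s -> s \in `[p, q] -> c s = d s) -> derive1 c t = derive1 d t.
Proof.
move=> pq /andP[pt tq] oU Ut dc dd cd.
have ctdt : c t = d t by apply: cd => //; rewrite in_itv/= pt.
have nU : \forall h \near (0 : R), U (h + t).
  have ct : (h + t) @[h --> (0 : R)] --> t.
    rewrite -[X in _ --> X]add0r; apply: cvgD; [exact: cvg_id|exact: cvg_cst].
  by apply: ct; exact: open_nbhs_nbhs.
have qc := difference_quotient_cvg dc; have qd := difference_quotient_cvg dd.
have [ltq|] := ltP t q.
  apply: (cvg_unique (@norm_hausdorff R V) (F := h^-1 *: (c (h + t) - c t) @[h --> 0^'+])).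
    exact: cvg_dnbhs_at_right.
  apply: cvg_trans (cvg_dnbhs_at_right qd); apply: near_eq_cvg.
  near=> h; rewrite ctdt cd//; first by near: h; exact: (cvg_within _ nU).
  rewrite in_itv/=; apply/andP; split; first by rewrite (le_trans pt)// lerDr.
  by rewrite -lerBrDr; near: h; apply: nbhs_right_le; rewrite subr_gt0.
move=> qt; have {qt} E : t = q by apply/eqP; rewrite eq_le tq.
apply: (cvg_unique (@norm_hausdorff R V) (F := h^-1 *: (c (h + t) - c t) @[h --> 0^'-])).
  exact: cvg_dnbhs_at_left.
apply: cvg_trans (cvg_dnbhs_at_left qd); apply: near_eq_cvg.
near=> h; rewrite ctdt cd//; first by near: h; exact: (cvg_within _ nU).
rewrite in_itv/=; apply/andP; split; last by rewrite -E gerDr.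
by rewrite -lerBlDr; near: h; apply: nbhs_left_ge; rewrite subr_lt0 E.
Unshelve. all: by end_near. Qed.

End difference_quotients.

(** * Smooth paths in charts and their speed *)

Section local_representatives.
Variables (R : realType) (n : nat) (X : finsler_manifold R n).
Implicit Types (alpha : R -> X) (c : R -> 'rV[R]_n).

(** The data in [smooth_path], without the condition U t, so that one representative serves at all
    points of U. *)
Definition local_rep alpha (p q : R) (i : chart_index X) (U : set R) c : Prop :=
  [/\ open U, smooth_on U c &
      forall s, U s -> s \in `[p, q] ->
        chart_dom i (alpha s) /\ chart i (alpha s) = c s].

Lemma chart_img_open2 (i j : chart_index X) :
  open (chart i @` (chart_dom i `&` chart_dom j) : set 'rV[R]_n).
Proof.
rewrite openE => _ [y [yi yj] <-].
have W : nbhs (chart i y) (chart i @` @chart_dom R n X i).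
  by apply: open_nbhs_nbhs; split; [exact: chart_img_open|exists y].
have := @chart_inv_continuous R n X i (chart i y) (ex_intro2 _ _ y yi erefl).
move=> /(_ (chart_dom j)); rewrite chartK// => /(_ (open_nbhs_nbhs _)) H.
have {}H : nbhs (chart i y) (chart_inv i @^-1` @chart_dom R n X j).
  by apply: H; split=> //; exact: chart_dom_open.
apply: filterS2 W H => _ [z zi <-] /=; rewrite chartK// => zj.
by exists z.
Qed.

Lemma smooth_on_differentiable (V W : normedModType R) (U : set V) (f : V -> W) x :
  smooth_on U f -> U x -> differentiable f x.
Proof. by move=> /(_ 1%N) [+ _]; exact. Qed.

(** By the chain rule the differential of the transition map sends the derivative of c to that of d,
    and [fnorm_compat] applies. End points are covered by [derive1_eq_on_segment]. *)
Lemma local_rep_speed alpha (p q t : R) (i : chart_index X) U c (j : chart_index X) V d :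
  p < q -> t \in `[p, q] ->
  local_rep alpha p q i U c -> U t -> local_rep alpha p q j V d -> V t ->
  fnorm (finsler X) j (alpha t) (derive1 d t) = fnorm (finsler X) i (alpha t) (derive1 c t).
Proof.
move=> pq tpq [oU sc Hc] Ut [oV sd Hd] Vt.
have [ti ct] := Hc t Ut tpq; have [tj dt] := Hd t Vt tpq.
rewrite -(fnorm_compat _ _ ti tj); congr fnorm.
have dc := smooth_on_differentiable sc Ut; have dd := smooth_on_differentiable sd Vt.
have dij : differentiable (chart j \o @chart_inv R n X i) (c t).
  apply: (smooth_on_differentiable (@transition_smooth R n X i j)).
  by exists (alpha t).
rewrite ct.
transitivity (derive1 ((chart j \o @chart_inv R n X i) \o c) t).
  apply: (@derive1_eq_on_segment _ _ _ _ p q t (U `&` V)) => //.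
  - exact: openI.
  - exact: differentiable_comp.
  - move=> s [Us Vs] spq /=; have [si cs] := Hc s Us spq; have [sj ds] := Hd s Vs spq.
    by rewrite -cs chartK.
rewrite (derive1E' (differentiable_comp dc dij)) (derive1E' dc).
exact: (congr1 (fun g => g 1) (diff_comp dc dij)).
Qed.

Lemma fnorm_cvg (i : chart_index X) (T : Type) (F : set_system T) {FF : Filter F} (f : T -> X)
    (v : T -> 'rV[R]_n) x w : chart_dom i x -> f @ F --> x -> v @ F --> w ->
  fnorm (finsler X) i (f t) (v t) @[t --> F] --> fnorm (finsler X) i x w.
Proof.
move=> xi cf cv.
exact: cvg_comp (cvg_pair cf cv) (@fnorm_continuous R n X (finsler X) i x w xi).
Qed.

Lemma smooth_on_derive1_cvg (U : set R) c t : open U -> U t -> smooth_on U c ->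
  derive1 c s @[s --> t] --> derive1 c t.
Proof.
move=> oU Ut sc.
have [dc /(_ 1)/= cont] := sc 1%N.
rewrite derive1E'; last exact: dc.
apply: cvg_trans (cont t Ut); apply: near_eq_cvg.
have : nbhs t U by exact: open_nbhs_nbhs.
by apply: filterS => s Us; rewrite derive1E'//; exact: dc.
Qed.

Lemma local_rep_cvg alpha (p q : R) (i : chart_index X) U c t : local_rep alpha p q i U c -> U t ->
  t \in `[p, q] -> alpha s @[s --> within `[p, q] (nbhs t)] --> alpha t.
Proof.
move=> [oU sc Hc] Ut tpq; have [ti ct] := Hc t Ut tpq.
have cc : c s @[s --> within `[p, q] (nbhs t)] --> c t.
  apply: cvg_trans (differentiable_continuous (smooth_on_differentiable sc Ut)).
  by apply: cvg_app; exact: cvg_within.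
have ci : {for c t, continuous (@chart_inv R n X i)}.
  by apply: chart_inv_continuous; exists (alpha t).
have := cvg_comp _ _ cc ci; rewrite -ct chartK//.
apply: cvg_trans; apply: near_eq_cvg; rewrite near_withinE.
have : nbhs t U by exact: open_nbhs_nbhs.
by apply: filterS => s Us spq /=; have [si <-] := Hc s Us spq; rewrite chartK.
Qed.

(* [speed] has junk values at the end points, where [st] takes the one-sided limits. *)
Lemma smooth_path_speed alpha (p q : R) : p < q -> smooth_path alpha p q ->
  exists st : R -> R, [/\ {within `[p, q], continuous st},
    {in `]p, q[, speed alpha =1 st} &
    forall t i U c, t \in `[p, q] -> local_rep alpha p q i U c -> U t ->
      st t = fnorm (finsler X) i (alpha t) (derive1 c t)].
Proof.
move=> pq sm.
have rep t i : t \in `[p, q] -> chart_dom i (alpha t) ->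
    exists Uc : set R * (R -> 'rV[R]_n), local_rep alpha p q i Uc.1 Uc.2 /\ Uc.1 t.
  by move=> tpq ti; have [U [c [oU Ut sc Hc]]] := sm t tpq i ti; exists (U, c).
have dom_at t : chart_dom (chart_at (alpha t)) (alpha t).
  by rewrite /chart_at; exact: (projT2 (cid (chart_cover (alpha t)))).
(* The representative is chosen separately at each t; [local_rep_speed] makes the value independent
   of the choice, hence continuous. *)
pose st t := if pselect (t \in `[p, q]) is left h
  then fnorm (finsler X) (chart_at (alpha t)) (alpha t)
         (derive1 (sval (cid (rep t _ h (dom_at t)))).2 t) else 0.
have stE t i U c : t \in `[p, q] -> local_rep alpha p q i U c -> U t ->
    st t = fnorm (finsler X) i (alpha t) (derive1 c t).
  move=> tpq Hc Ut; rewrite /st; case: pselect => // h.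
  case: cid => -[V d] /= [Hd Vt]; exact: (local_rep_speed pq tpq Hc Ut Hd Vt).
exists st; split=> //.
  apply/subspace_continuousP => t tpq.
  have {}tpq : t \in `[p, q] by [].
  have [i ti] := chart_cover (alpha t).
  have [[U c]/= [Hc Ut]] := rep t i tpq ti.
  rewrite /from_subspace (stE t i U c tpq Hc Ut); have [oU sc Hc'] := Hc.
  have cv : derive1 c s @[s --> within `[p, q] (nbhs t)] --> derive1 c t.
    apply: cvg_trans (smooth_on_derive1_cvg oU Ut sc).
    by apply: cvg_app; exact: cvg_within.
  apply: cvg_trans (fnorm_cvg ti (local_rep_cvg Hc Ut tpq) cv); apply: near_eq_cvg.
  rewrite near_withinE.
  have : nbhs t U by exact: open_nbhs_nbhs.
  by apply: filterS => s Us spq; rewrite (stE s i U c spq Hc Us).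
move=> t tpq.
have tpq' : t \in `[p, q] by apply: subset_itv_oo_cc tpq.
have [[U c]/= [Hc Ut]] := rep t _ tpq' (dom_at t).
rewrite (stE t _ U c tpq' Hc Ut) /speed; congr fnorm; rewrite !derive1E; apply: near_eq_derive.
have [oU sc Hc'] := Hc.
have nU : nbhs t U by exact: open_nbhs_nbhs.
have nI : nbhs t `]p, q[%classic by exact: near_in_itvoo.
apply: filterS2 nU nI => s Us spq /=.
by have [_ ->] := Hc' s Us (subset_itv_oo_cc spq).
Qed.

End local_representatives.

Section interval_integrals.
Variable R : realType.
Local Notation mu := (@lebesgue_measure R).

Lemma integrable_itv_oo_cc (f : R -> R) (p q : R) :
  mu.-integrable `]p, q[ (EFin \o f) -> mu.-integrable `[p, q] (EFin \o f).
Proof.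
move=> /integrableP[mf fi]; apply/integrableP; split.
  exact: emeasurable_fun_itv_cc mf.
by rewrite integral_itv_bndoo//; exact: measurableT_comp.
Qed.

Lemma integrable_itv_setU (f : R -> R) (a x b : R) : a <= x -> x <= b ->
  mu.-integrable `[a, x] (EFin \o f) -> mu.-integrable `[x, b] (EFin \o f) ->
  mu.-integrable `[a, b] (EFin \o f).
Proof.
move=> ax xb /integrableP[m1 i1] /integrableP[m2 i2].
have m3 : measurable_fun `]x, b] (EFin \o f).
  by apply: measurable_funS m2 => //; apply: subset_itvr; rewrite bnd_simp.
have E : `[a, b]%classic = `[a, x]%classic `|` `]x, b]%classic :> set R.
  by rewrite -itv_bndbnd_setU// bnd_simp.
have m : measurable_fun `[a, b] (EFin \o f).
  by rewrite E measurable_funU.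
apply/integrableP; split=> //.
rewrite E ge0_integral_setU//; last first.
- apply/disj_setPS => y [/=]; rewrite 2!in_itv/= => /andP[_ yx] /andP[].
  by rewrite ltNge yx.
- by rewrite -E; exact: measurableT_comp.
apply: lte_add_pinfty => //; apply: le_lt_trans i2.
apply: ge0_subset_integral => //; first exact: measurableT_comp.
by apply: subset_itvr; rewrite bnd_simp.
Qed.

Lemma Rintegral_itv_setU (f : R -> R) (a x b : R) : a <= x -> x <= b ->
  mu.-integrable `[a, b] (EFin \o f) ->
  \int[mu]_(t in `[a, b]) f t =
  \int[mu]_(t in `[a, x]) f t + \int[mu]_(t in `[x, b]) f t.
Proof.
move=> ax xb fi.
have ax' : (BLeft a <= BRight x)%O by rewrite bnd_simp.
have xb' : (BRight x <= BRight b)%O by rewrite bnd_simp.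
have H := Rintegral_itvB fi ax' xb'.
rewrite -(@Rintegral_itv_obnd_cbnd _ x); last first.
  by apply: integrableS fi => //; apply: subset_itvr; rewrite bnd_simp.
by rewrite -H addrC subrK.
Qed.

End interval_integrals.

(** The end points, where [speed] may be a default value, form a null set. Integrability is recorded
    because lengths are later split at break points. *)
Lemma path_lengthE (R : realType) (n : nat) (X : finsler_manifold R n) (alpha : R -> X)
    (p q : R) (st : R -> R) :
  {within `[p, q], continuous st} -> {in `]p, q[, speed alpha =1 st} ->
  (@lebesgue_measure R).-integrable `[p, q] (EFin \o speed alpha) /\
  path_length alpha p q = \int[@lebesgue_measure R]_(t in `[p, q]) st t.
Proof.
move=> cst spE; set mu := @lebesgue_measure R.
have ist : mu.-integrable `[p, q] (EFin \o st).
  by apply: continuous_compact_integrable => //; exact: segment_compact.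
have isp : mu.-integrable `]p, q[ (EFin \o speed alpha).
  have ist' : mu.-integrable `]p, q[ (EFin \o st).
    by apply: integrableS ist => //; exact: subset_itv_oo_cc.
  apply: eq_integrable ist' => // t; rewrite inE => tpq.
  by rewrite /= spE.
have {}isp := integrable_itv_oo_cc isp.
split=> //; rewrite /path_length /Rintegral; congr fine.
have mcc (g : R -> R) : mu.-integrable `[p, q] (EFin \o g) -> measurable_fun `]p, q[ g.
  move=> /integrableP[/measurable_EFinP mg _]; apply: measurable_funS mg => //.
  exact: subset_itv_oo_cc.
by apply: eq_integral_itv_bounded; [exact: mcc|exact: mcc|].
Qed.

(** * Lengths bounded below by infinitesimally 1-Lipschitz functions *)

Section length_lower_bound.
Variables (R : realType) (n : nat) (X : finsler_manifold R n).
Variable Phi : X -> R.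
Hypothesis Phi_cont : continuous Phi.
Hypothesis Phi_lip : forall y, exists2 i : chart_index X, chart_dom i y &
  \forall z \near y, Phi z - Phi y <= fnorm (finsler X) i y (chart i z - chart i y).
Local Notation mu := (@lebesgue_measure R).

Lemma smooth_path_dini (alpha : R -> X) (p q t : R) (st : R -> R) :
  p <= t < q -> smooth_path alpha p q ->
  (forall i U c, local_rep alpha p q i U c -> U t ->
    st t = fnorm (finsler X) i (alpha t) (derive1 c t)) ->
  forall e, 0 < e ->
  \forall t' \near t^'+, Phi (alpha t') - Phi (alpha t) <= (st t + e) * (t' - t).
Proof.
move=> /andP[pt tq] sm stE e e0.
have tpq : t \in `[p, q] by rewrite in_itv/= pt ltW.
have [i ti Hi] := Phi_lip (alpha t).
have [U [c [oU Ut sc Hc]]] := sm t tpq i ti.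
have rep : local_rep alpha p q i U c by split.
rewrite (stE i U c rep Ut).
have ca := local_rep_cvg rep Ut tpq.
have dc := smooth_on_differentiable sc Ut.
have cN : fnorm (finsler X) i (alpha t) (h^-1 *: (c (h + t) - c t)) @[h --> 0^'+] -->
    fnorm (finsler X) i (alpha t) (derive1 c t).
  apply: fnorm_cvg => //; first exact: cvg_cst.
  exact: cvg_dnbhs_at_right (difference_quotient_cvg dc).
have /cvgrPdist_le/(_ e e0) := cN; rewrite near_withinE => N1.
have {}N1 : \forall t' \near t, t < t' ->
   fnorm (finsler X) i (alpha t) ((t' - t)^-1 *: (c t' - c t)) <=
   fnorm (finsler X) i (alpha t) (derive1 c t) + e.
  have : (t' - t) @[t' --> t] --> (0 : R).
    by rewrite -(subrr t); apply: cvgB; [exact: cvg_id|exact: cvg_cst].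
  move=> /(_ _ N1) N2.
  have {}N2 : \forall t' \near t, 0 < t' - t ->
    `|fnorm (finsler X) i (alpha t) (derive1 c t) -
      fnorm (finsler X) i (alpha t) ((t' - t)^-1 *: (c (t' - t + t) - c t))| <= e := N2.
  apply: filterS N2 => t' N2 tt'.
  by move: N2; rewrite subr_gt0 subrK => /(_ tt'); rewrite ler_distlC => /andP[].
have {}Hi : \forall t' \near t, t' \in `[p, q] -> Phi (alpha t') - Phi (alpha t) <=
    fnorm (finsler X) i (alpha t) (chart i (alpha t') - chart i (alpha t)).
  exact: (ca _ Hi).
have nU : nbhs t U by exact: open_nbhs_nbhs.
have [_ ct] := Hc t Ut tpq.
near=> t'.
have tt' : t < t' by near: t'; exact: nbhs_right_gt.
have t'pq : t' \in `[p, q].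
  rewrite in_itv/= (le_trans pt (ltW tt'))/=.
  by near: t'; exact: nbhs_right_le.
have h1 : t' \in `[p, q] -> Phi (alpha t') - Phi (alpha t) <=
    fnorm (finsler X) i (alpha t) (chart i (alpha t') - chart i (alpha t)).
  by near: t'; exact: cvg_within _ Hi.
have h2 : t < t' -> fnorm (finsler X) i (alpha t) ((t' - t)^-1 *: (c t' - c t)) <=
   fnorm (finsler X) i (alpha t) (derive1 c t) + e.
  by near: t'; exact: cvg_within _ N1.
have Ut' : U t' by near: t'; exact: cvg_within _ nU.
have [_ ct'] := Hc t' Ut' t'pq.
apply: le_trans (h1 t'pq) _; rewrite ct ct'.
have := h2 tt'; rewrite fnormZ// normfV ger0_norm; last by rewrite subr_ge0 ltW.
by rewrite ler_pdivrMl ?subr_gt0// mulrC.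
Unshelve. all: by end_near. Qed.

Lemma smooth_path_length_ge (alpha : R -> X) p q : p < q -> smooth_path alpha p q ->
  mu.-integrable `[p, q] (EFin \o speed alpha) /\
  Phi (alpha q) - Phi (alpha p) <= path_length alpha p q.
Proof.
move=> pq sm; have [st [cst spE stE]] := smooth_path_speed pq sm.
have [isp ->] := path_lengthE cst spE; split=> //.
apply: (@le_integral_of_dini _ (Phi \o alpha)) => //.
  apply/subspace_continuousP => t tpq.
  have [i ti] := chart_cover (alpha t).
  have [U [c [oU Ut sc Hc]]] := sm t tpq i ti.
  have rep : local_rep alpha p q i U c by split.
  exact: cvg_comp (local_rep_cvg rep Ut tpq) (Phi_cont (x := alpha t)).
move=> t tpq; apply: smooth_path_dini sm _ => // i U c.
by apply: stE; move: tpq; rewrite in_itv/= => /andP[-> /ltW].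
Qed.

Lemma path_length_ge (alpha : R -> X) a b : a < b -> piecewise_smooth_path alpha a b ->
  Phi (alpha b) - Phi (alpha a) <= path_length alpha a b.
Proof.
move=> ab [s ps sm].
(* The induction on the break points carries integrability, which is needed to split the
   integral. *)
suff : mu.-integrable `[a, b] (EFin \o speed alpha) /\
  Phi (alpha b) - Phi (alpha a) <= path_length alpha a b by case.
elim: s a ab ps sm => [a ab /itv_partition_nil ab'|x s IH a ab ps sm].
  by rewrite ab' ltxx in ab.
have ax : a < x by case: ps => /= /andP[].
have sm0 : smooth_path alpha a x by exact: (sm 0%N).
have [i1 l1] := smooth_path_length_ge ax sm0.
have ps' := itv_partition_cons ps.
have := itv_partition_le ps'; rewrite le_eqVlt => /predU1P[<-//|xb].
have [i2 l2] : mu.-integrable `[x, b] (EFin \o speed alpha) /\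
  Phi (alpha b) - Phi (alpha x) <= path_length alpha x b.
  apply: (IH x xb ps') => k ks; exact: (sm k.+1).
have i12 := integrable_itv_setU (ltW ax) (ltW xb) i1 i2.
split=> //; rewrite /path_length (Rintegral_itv_setU (ltW ax) (ltW xb) i12).
move: l1 l2; rewrite /path_length; lra.
Qed.

End length_lower_bound.

(** * The distance in a chart *)

Section norms_on_row_vectors.
Variables (R : realType) (n : nat).
Local Notation V := 'rV[R]_n.

Lemma compact_unit_sphere : compact [set v : V | `|v| = 1].
Proof.
apply: bounded_closed_compact.
  by exists 1; split=> // M M1 v /= ->; exact: ltW.
have -> : [set v : V | `|v| = 1] = (fun v : V => `|v|) @^-1` [set 1] by [].
apply: preimage_closed; last exact: closed_eq.
by move=> v _; exact: norm_continuous.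
Qed.

Lemma unit_sphere_scale (v : V) : v != 0 ->
  exists2 u : V, `|u| = 1 & v = `|v| *: u.
Proof.
move=> v0; exists (`|v|^-1 *: v).
  by rewrite normrZ normfV normr_id mulVf// normr_eq0.
by rewrite scalerA divff ?scale1r// normr_eq0.
Qed.

(** Near each unit vector N is bounded above and away from 0; compactness of the sphere, in its
    covering form, gives one constant, and homogeneity extends it to all vectors. *)
Lemma norm_equivalent (N : V -> R) : is_norm N -> continuous N ->
  exists2 K, 0 < K & forall v, N v <= K * `|v| /\ `|v| <= K * N v.
Proof.
move=> Nn cN.
have : \forall M \near +oo%R, [set v : V | `|v| = 1] `<=` [set v | N v <= M /\ 1 <= M * N v].
  have := (compact_near_coveringP _).1 compact_unit_sphere.
  move=> /(_ R (pinfty_nbhs R) (fun M v => N v <= M /\ 1 <= M * N v)); apply.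
  move=> v /= v1.
  have Nv0 : 0 < N v.
    by apply: (norm_gt0 Nn); rewrite -normr_gt0 v1.
  have H1 : \forall v' \near v, N v' < N v + 1.
    by apply: cvgr_lt (cN v) _ _; rewrite ltrDl.
  have H2 : \forall v' \near v, N v / 2 < N v'.
    have half : N v / 2 < N v by lra.
    exact: cvgr_gt (cN v) _ half.
  near=> v' M.
  have h1 : N v' < N v + 1 by near: v'.
  have h2 : N v / 2 < N v' by near: v'.
  have h3 : N v + 1 <= M by near: M; apply: nbhs_pinfty_ge; exact: num_real.
  have h4 : 2 / N v <= M by near: M; apply: nbhs_pinfty_ge; exact: num_real.
  split; first by rewrite (le_trans (ltW h1)).
  have M0 : 0 <= M by apply: le_trans h4; rewrite divr_ge0// ltW.
  apply: (@le_trans _ _ (2 / N v * (N v / 2))).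
    by rewrite le_eqVlt; apply/orP; left; apply/eqP; field; rewrite lt0r_neq0.
  by rewrite ler_pM// ?divr_ge0// ltW.
move=> H; near (+oo%R : set_system R) => M.
have M0 : 0 < M by near: M; apply: nbhs_pinfty_gt; exact: num_real.
have HM : [set v : V | `|v| = 1] `<=` [set v | N v <= M /\ 1 <= M * N v] by near: M.
exists M => // v; have [->|v0] := eqVneq v 0.
  by rewrite (norm_zero Nn) normr0 mulr0.
have [u u1 ->] := unit_sphere_scale v0.
have [h1 h2] := HM u u1.
rewrite (norm_scale Nn) !normrZ !normr_id u1 mulr1.
by split; [rewrite mulrC ler_wpM2r|rewrite mulrCA ler_peMr].
Unshelve. all: by end_near. Qed.

End norms_on_row_vectors.

Section chart_norms.
Variables (R : realType) (n : nat) (X : finsler_manifold R n).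

Lemma fnorm_is_norm (i : chart_index X) x : chart_dom i x -> is_norm (fnorm (finsler X) i x).
Proof.
move=> xi; split.
- by move=> v; exact: fnorm_ge0.
- by move=> v; exact: fnorm_eq0.
- by move=> c v; exact: fnormZ.
- by move=> u v; exact: fnormD.
Qed.

Lemma fnorm_continuous_fiber (i : chart_index X) x :
  chart_dom i x -> continuous (fnorm (finsler X) i x).
Proof.
move=> xi v.
by apply: (@fnorm_cvg _ _ _ i _ (nbhs v) _ (fun=> x) id x v xi); [exact: cvg_cst|exact: cvg_id].
Qed.

(** Joint continuity on the tangent bundle becomes uniform over the compact unit sphere; homogeneity
    turns this into a relative error. *)
Lemma fnorm_near (i : chart_index X) x0 (e : R) : chart_dom i x0 -> 0 < e ->
  \forall x \near x0, forall v,
    (1 - e) * fnorm (finsler X) i x0 v <= fnorm (finsler X) i x v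
      <= (1 + e) * fnorm (finsler X) i x0 v.
Proof.
move=> xi e0; pose N := fnorm (finsler X) i.
have Nn := fnorm_is_norm xi.
have : \forall x \near x0, [set v : 'rV[R]_n | `|v| = 1] `<=`
    [set v | `|N x v - N x0 v| <= e * N x0 v].
  have := (compact_near_coveringP _).1 (@compact_unit_sphere R n).
  move=> /(_ X (nbhs x0) (fun x v => `|N x v - N x0 v| <= e * N x0 v)); apply.
  move=> v /= v1.
  have Nv0 : 0 < N x0 v.
    by apply: (norm_gt0 Nn); rewrite -normr_gt0 v1.
  have c1 : N u.2 u.1 @[u --> filter_prod (nbhs v) (nbhs x0)] --> N x0 v.
    by apply: (fnorm_cvg (f := snd) (v := fst) xi); [exact: cvg_snd|exact: cvg_fst].
  have c2 : N x0 u.1 @[u --> filter_prod (nbhs v) (nbhs x0)] --> N x0 v.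
    by apply: (fnorm_cvg (f := fun=> x0) (v := fst) xi); [exact: cvg_cst|exact: cvg_fst].
  have c3 : e * N x0 u.1 - `|N u.2 u.1 - N x0 u.1|
      @[u --> filter_prod (nbhs v) (nbhs x0)] --> e * N x0 v - `|N x0 v - N x0 v|.
    by apply: cvgB; [exact: cvgMr|apply: cvg_norm; exact: cvgB].
  rewrite subrr normr0 subr0 in c3.
  have FF : Filter (filter_prod (nbhs v) (nbhs x0)) by exact: filter_prod_filter.
  have c4 := cvgr_gt _ c3 0 (mulr_gt0 e0 Nv0).
  have {}c4 : filter_prod (nbhs v) (nbhs x0)
    (fun u => 0 < e * N x0 u.1 - `|N u.2 u.1 - N x0 u.1|) := c4 FF.
  suff : filter_prod (nbhs v) (nbhs x0)
    (fun u => `|N u.2 u.1 - N x0 u.1| <= e * N x0 u.1) by [].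
  by apply: filterS c4 => u h; rewrite -subr_ge0 ltW.
have nd : nbhs x0 (@chart_dom R n X i) by apply: open_nbhs_nbhs; split=> //; exact: chart_dom_open.
apply: filterS2 nd => x xd Hx v.
have Nxn := fnorm_is_norm xd.
have [->|v0] := eqVneq v 0; first by rewrite (norm_zero Nn) (norm_zero Nxn) !mulr0 lexx.
have [u u1 ->] := unit_sphere_scale v0.
have := Hx u u1; rewrite /= ler_distl.
rewrite (norm_scale Nn) (norm_scale Nxn) normr_id => /andP[h1 h2].
have := normr_ge0 v; move: (`|v|) => t t0.
apply/andP; split; rewrite mulrCA ler_wpM2l// /N.
  by move: h1; rewrite /N; lra.
by move: h2; rewrite /N; lra.
Qed.

End chart_norms.

Section affine_lines.
Variables (R : realType) (V W : normedModType R).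
Implicit Types (x w : V).

Definition line x w (t : R) : V := x + t *: w.

Lemma is_derive_line x w (t : R) : is_derive t 1 (line x w) w.
Proof.
have H : is_derive t 1 (fun s : R => s *: w) w.
  have [d E] := is_diff_scalel t w.
  by split; [exact/derivable1_diffP|rewrite deriveE// E/= scale1r].
by rewrite -[X in is_derive _ _ _ X]add0r; exact: is_deriveD.
Qed.

Lemma derive1_line x w t : derive1 (line x w) t = w.
Proof. by have := is_derive_line x w t; rewrite derive1E => -[]. Qed.

Lemma differentiable_line x w t : differentiable (line x w) t.
Proof. by apply/derivable1_diffP; have [] := is_derive_line x w t. Qed.

Lemma continuous_line x w : continuous (line x w).
Proof. by move=> t; apply: differentiable_continuous; exact: differentiable_line. Qed.

(** [Ck_on] recurs on x => 'd f x v, so the induction is over all pairs with g = f along the line on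
    U: the differential of g in direction v is that of f in direction v w, again such a pair. *)
Lemma smooth_on_comp_line (O : set V) (f : V -> W) x w (U : set R) (g : R -> W) :
  open U -> (forall t, U t -> O (line x w t)) ->
  (forall t, U t -> g t = f (line x w t)) -> smooth_on O f -> smooth_on U g.
Proof.
move=> oU UO gf sf k; have := sf k; elim: k f g gf {sf} => [|k IH] f g gf /=.
  move=> cf t Ut.
  have H := cvg_comp _ _ (@continuous_line x w t) (cf _ (UO t Ut)).
  rewrite -(gf t Ut) in H; apply: cvg_trans H.
  apply: near_eq_cvg; have : nbhs t U by exact: open_nbhs_nbhs.
  by apply: filterS => s Us /=; rewrite gf.
move=> [df Cf].
have nfg t : U t -> {near t, f \o line x w =1 g}.
  move=> Ut; have : nbhs t U by exact: open_nbhs_nbhs.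
  by apply: filterS => s Us /=; rewrite gf.
have dfl t : U t -> differentiable (f \o line x w) t.
  by move=> Ut; apply: differentiable_comp; [exact: differentiable_line|exact: df (UO t Ut)].
have dg t : U t -> differentiable g t.
  move=> Ut; apply/derivable1_diffP.
  apply: near_eq_derivable (nfg t Ut) _.
  by apply/derivable1_diffP; exact: dfl.
split=> // v.
apply: (IH (fun y => 'd f y (v *: w))); last exact: Cf.
move=> t Ut; rewrite -[v in LHS]mulr1 -[v * 1]/(v *: (1 : R^o)) linearZ/=.
rewrite -derive1E'; last exact: dg.
rewrite derive1E -(near_eq_derive _ (nfg t Ut)) -derive1E derive1E'; last exact: dfl.
have E := congr1 (fun h => h (1 : R)) (diff_comp (differentiable_line x w t) (df _ (UO t Ut))).
rewrite E /= -derive1E'; last exact: differentiable_line.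
by rewrite derive1_line linearZ.
Qed.

End affine_lines.

Section chart_segments.
Variables (R : realType) (n : nat) (X : finsler_manifold R n).
Variable i : chart_index X.
Local Notation inv := (@chart_inv R n X i).
Local Notation img := (chart i @` @chart_dom R n X i).

Lemma chart_img_inv y : img y -> chart_dom i (inv y) /\ chart i (inv y) = y.
Proof. by move=> [x xi <-]; rewrite chartK. Qed.

Lemma segment_rep (x w : 'rV[R]_n) (p q t : R) (j : chart_index X) :
  chart_dom j (inv (line x w t)) -> img (line x w t) ->
  let U := line x w @^-1` (chart i @` (chart_dom i `&` chart_dom j)) in
  local_rep (inv \o line x w) p q j U (chart j \o inv \o line x w) /\ U t.
Proof.
move=> tj ti U.
have oU : open U.
  by apply: open_comp; [move=> s _; exact: continuous_line|exact: chart_img_open2].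
split; last by have [h1 h2] := chart_img_inv ti; exists (inv (line x w t)).
split=> //.
  apply: (@smooth_on_comp_line _ _ _
    (chart i @` (@chart_dom R n X i `&` @chart_dom R n X j)) (chart j \o inv) x w) => //.
  exact: transition_smooth.
by move=> s [z [zi zj] zs] _ /=; rewrite -zs chartK.
Qed.

Lemma segment_smooth (x w : 'rV[R]_n) (p q : R) :
  (forall t, t \in `[p, q] -> img (line x w t)) -> smooth_path (inv \o line x w) p q.
Proof.
move=> H t tpq j tj.
have [[oU sU HU] Ut] := segment_rep p q tj (H t tpq).
by exists (line x w @^-1` (chart i @` (chart_dom i `&` chart_dom j))),
   (chart j \o inv \o line x w); split.
Qed.

Lemma segment_length_le (x w : 'rV[R]_n) (p q M : R) : p < q ->
  (forall t, t \in `[p, q] -> img (line x w t) /\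
     fnorm (finsler X) i (inv (line x w t)) w <= M) ->
  path_length (inv \o line x w) p q <= M * (q - p).
Proof.
move=> pq H.
have sm : smooth_path (inv \o line x w) p q.
  by apply: segment_smooth => t /H[].
have [st [stc spE stE]] := smooth_path_speed pq sm.
have [_ ->] := path_lengthE stc spE.
have stM t : t \in `[p, q] -> st t <= M.
  move=> tpq; have [ti tM] := H t tpq; have [ti' ct] := chart_img_inv ti.
  have [rep Ut] := segment_rep p q ti' ti.
  rewrite (stE t i _ _ tpq rep Ut).
  suff -> : derive1 (chart i \o inv \o line x w) t = w by [].
  rewrite -[RHS](derive1_line x w t) !derive1E; apply: near_eq_derive.
  have [oU _ _] := rep.
  have nU := open_nbhs_nbhs (conj oU Ut).
  by apply: filterS nU => s [z [zi _] zs] /=; rewrite -zs chartK.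
have ist : (@lebesgue_measure R).-integrable `[p, q] (EFin \o st).
  by apply: continuous_compact_integrable => //; exact: segment_compact.
have iM : (@lebesgue_measure R).-integrable `[p, q] (EFin \o cst M).
  apply: continuous_compact_integrable; first exact: segment_compact.
  by apply: continuous_subspaceT => z; exact: cvg_cst.
have -> : M * (q - p) = \int[@lebesgue_measure R]_(t in `[p, q]) (cst M t).
  by rewrite Rintegral_cst//= lebesgue_measure_itv/= lte_fin pq -EFinD.
by apply: le_Rintegral.
Qed.

Lemma path_length_ge0 (alpha : R -> X) a b : 0 <= path_length alpha a b.
Proof.
apply: Rintegral_ge0 => t _; apply: fnorm_ge0.
by rewrite /chart_at; exact: (projT2 (cid (chart_cover (alpha t)))).
Qed.

Lemma fdist_le_length (alpha : R -> X) a b : a < b -> piecewise_smooth_path alpha a b ->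
  fdist (alpha a) (alpha b) <= path_length alpha a b.
Proof.
move=> ab ps; apply: ge_inf; last by exists a, b, alpha.
by exists 0 => l [a' [b' [al [_ _ _ _ ->]]]]; exact: path_length_ge0.
Qed.

Lemma piecewise_of_smooth_path (alpha : R -> X) a b : a < b ->
  smooth_path alpha a b -> piecewise_smooth_path alpha a b.
Proof.
move=> ab sm; exists [:: b]; first exact: itv_partition1.
by case.
Qed.

(** The given path shows that the set in [fdist] is nonempty; the [inf] of an empty set would be a
    default value. *)
Lemma fdist_ge (Phi : X -> R) (alpha : R -> X) a b : a < b ->
  piecewise_smooth_path alpha a b -> continuous Phi ->
  (forall y, exists2 j : chart_index X, chart_dom j y &
    \forall z \near y, Phi z - Phi y <= fnorm (finsler X) j y (chart j z - chart j y)) ->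
  Phi (alpha b) - Phi (alpha a) <= fdist (alpha a) (alpha b).
Proof.
move=> ab ps cPhi lPhi; apply: lb_le_inf.
  by exists (path_length alpha a b), a, b, alpha.
move=> l [a' [b' [al [ab' ps' <- <- ->]]]].
exact: path_length_ge.
Qed.

End chart_segments.

Lemma compact_closed_ball_rV (R : realType) (n : nat) (x : 'rV[R]_n) (r : R) :
  compact [set y : 'rV[R]_n | `|y - x| <= r].
Proof.
apply: bounded_closed_compact.
  exists (r + `|x|); split; first exact: num_real.
  move=> M rM y /= yr; apply: (le_trans _ (ltW rM)).
  by have := ler_normD (y - x) x; rewrite subrK => /le_trans; apply; rewrite lerD2r.
have -> : [set y : 'rV[R]_n | `|y - x| <= r] = (fun y => `|y - x|) @^-1` [set t | t <= r] by [].
apply: preimage_closed; last exact: closed_le.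
move=> y _.
exact: (cvg_norm (@cvgB _ _ _ (nbhs y) _ id (cst x) y x cvg_id (cvg_cst x))).
Qed.

(** * Comparison of the distance with the norm at one point *)

Section metric_in_a_chart.
Variables (R : realType) (n : nat) (X : finsler_manifold R n).
Variables (i : chart_index X) (x0 : X) (e r K : R).
Hypothesis x0i : chart_dom i x0.
Local Notation inv := (@chart_inv R n X i).
Local Notation img := (chart i @` @chart_dom R n X i).
Local Notation N0 := (fnorm (finsler X) i x0).
Local Notation xi0 := (chart i x0).
Hypotheses (e1 : e < 1) (r0 : 0 < r) (K0 : 0 < K).
Hypothesis near_img : forall z : 'rV[R]_n, `|z - xi0| < 2 * r -> img z /\
  forall v, (1 - e) * N0 v <= fnorm (finsler X) i (inv z) v <= (1 + e) * N0 v.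
Hypothesis N0K : forall v, N0 v <= K * `|v| /\ `|v| <= K * N0 v.

Let N0n := fnorm_is_norm x0i.

Section truncated_distance.
Variable xi : 'rV[R]_n.
Hypothesis xir : `|xi - xi0| < r / 2.

(** If |z - xi0| >= r, then |z - xi| >= r / 2 and N0 (z - xi) >= r / (2 K): this is the height that
    (1 - e) N0 (z - xi) has reached at radius r. *)
Let rho := (1 - e) * (r / (2 * K)).

(* [phi] is truncated at [rho] so that [Phi] is constant near the boundary of the chart. *)
Let phi (z : 'rV[R]_n) := Num.min ((1 - e) * N0 (z - xi)) rho.

(** Paths between two points of the chart may leave it, so the test function has to be defined on
    all of X. *)
Let Phi (y : X) :=
  if `[< chart_dom i y /\ `|chart i y - xi0| <= r >] then phi (chart i y) else rho.

Let rho_ge0 : 0 <= rho.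
Proof. by rewrite /rho mulr_ge0 ?subr_ge0 ?(ltW e1)// divr_ge0 ?mulr_ge0// ltW. Qed.

Let phi_lip z z' : phi z' - phi z <= (1 - e) * N0 (z' - z).
Proof.
have h : (1 - e) * N0 (z' - xi) <= (1 - e) * N0 (z - xi) + (1 - e) * N0 (z' - z).
  rewrite -mulrDr ler_wpM2l ?subr_ge0 ?(ltW e1)//.
  have := norm_add N0n (z - xi) (z' - z).
  by rewrite [z - xi + _]addrC addrA subrK.
have h0 : 0 <= (1 - e) * N0 (z' - z).
  by rewrite mulr_ge0 ?subr_ge0 ?(ltW e1)// (norm_ge0 N0n).
rewrite /phi; case: (leP ((1 - e) * N0 (z' - xi)) rho) => h1;
  case: (leP ((1 - e) * N0 (z - xi)) rho) => h2; lra.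
Qed.

Let phi_cont : continuous phi.
Proof.
move=> z; apply/(@cvgrPdist_lt _ _ _ (nbhs z) (nbhs_filter z)) => d d0.
have H1 : z' - z @[z' --> z] --> z - z.
  exact: (@cvgB _ _ _ (nbhs z) _ id (cst z) z z cvg_id (cvg_cst z)).
have H2 := cvg_comp _ _ H1 (@fnorm_continuous_fiber _ _ _ _ _ x0i (z - z)).
have H3 : (1 - e) * N0 (z' - z) @[z' --> z] --> (1 - e) * N0 (z - z).
  by apply: (@cvgMr _ _ (nbhs z)); exact: H2.
rewrite subrr (norm_zero N0n) mulr0 in H3.
have := (@cvgrPdist_lt _ _ _ (nbhs z) (nbhs_filter z) _ _).1 H3 d d0.
apply: filterS => z'; rewrite sub0r normrN => /(le_lt_trans (ler_norm _)) h.
have h1 := phi_lip z z'; have := phi_lip z' z; rewrite (norm_dist N0n z) => h2.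
rewrite ltr_norml; apply/andP; split; lra.
Qed.

(** Between the radii r and 2 r both descriptions of [Phi] agree, which glues them continuously. *)
Let V := [set y : X | chart_dom i y /\ `|chart i y - xi0| < 2 * r].

Let V_nbhs y : V y -> nbhs y V.
Proof.
move=> [yi yr].
have n1 : nbhs y (@chart_dom R n X i).
  by apply: open_nbhs_nbhs; split=> //; exact: chart_dom_open.
have : `|chart i z - xi0| @[z --> y] --> `|chart i y - xi0|.
  apply: cvg_norm; apply: cvgB; [exact: chart_continuous|exact: cvg_cst].
move=> /cvgr_lt/(_ _ yr) n2.
by apply: filterS2 n1 n2.
Qed.

Let PhiV y : V y -> Phi y = phi (chart i y).
Proof.
move=> [yi yr]; rewrite /Phi; case: asboolP => // /not_andP[//|/negP].
rewrite -ltNge => ry; rewrite /phi min_r// /rho.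
rewrite ler_wpM2l ?subr_ge0 ?(ltW e1)//.
rewrite ler_pdivrMr ?mulr_gt0//.
have [_ h] := N0K (chart i y - xi).
have : `|chart i y - xi0| <= `|chart i y - xi| + `|xi - xi0| by exact: ler_distD.
move: xir; lra.
Qed.

(** The closed coordinate ball of radius r is compact, so its image is closed in the Hausdorff space
    X. Hence a point outside [V] is not a limit of points where [Phi] differs from [rho]. *)
Let Phi_out y : ~ V y -> \forall z \near y, Phi z = rho.
Proof.
move=> yV.
pose C := inv @` [set z : 'rV[R]_n | `|z - xi0| <= r].
have r2 : r < 2 * r by rewrite ltr_pMl// ltr1n.
have cC : closed C.
  apply: compact_closed; first exact: manifold_hausdorff.
  apply: continuous_compact; last exact: compact_closed_ball_rV.
  apply: continuous_in_subspaceT => z; rewrite inE => zr.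
  apply: chart_inv_continuous; exact: (near_img (le_lt_trans zr r2)).1.
have yC : ~ C y.
  move=> [z zr zy]; apply: yV; have [zi _] := near_img (le_lt_trans zr r2).
  have [h1 h2] := chart_img_inv zi; split; rewrite -zy// h2.
  exact: le_lt_trans zr r2.
have : nbhs y (~` C) by apply: open_nbhs_nbhs; split=> //; exact: closed_openC.
apply: filterS => z zC; rewrite /Phi; case: asboolP => // -[zi zr].
by exfalso; apply: zC; exists (chart i z); rewrite ?chartK.
Qed.

Let Phi_cont : continuous Phi.
Proof.
move=> y; have [yV|yV] := pselect (V y).
  have H : (phi \o chart i) z @[z --> y] --> phi (chart i y).
    exact: (cvg_comp _ _ (chart_continuous yV.1) (@phi_cont (chart i y))).
  rewrite -(PhiV yV) in H; apply: cvg_trans H; apply: near_eq_cvg.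
  by apply: filterS (V_nbhs yV) => z /PhiV ->.
have H := Phi_out yV.
have C : cst rho z @[z --> y] --> Phi y by rewrite (nbhs_singleton H); exact: cvg_cst.
apply: cvg_trans C; apply: near_eq_cvg.
by apply: filterS H => z ->.
Qed.

(** The factor 1 - e in [phi] compensates for the variation of the norm: on [V] the norm at y is at
    least (1 - e) N0. *)
Let Phi_lip y : exists2 j : chart_index X, chart_dom j y &
  \forall z \near y, Phi z - Phi y <= fnorm (finsler X) j y (chart j z - chart j y).
Proof.
have [yV|yV] := pselect (V y).
  have [yi yr] := yV; exists i => //.
  apply: filterS (V_nbhs yV) => z zV; rewrite (PhiV yV) (PhiV zV).
  apply: le_trans (phi_lip _ _) _.
  by have [_ /(_ (chart i z - chart i y))/andP[+ _]] := near_img yr; rewrite chartK.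
have [j yj] := chart_cover y; exists j => //.
have H := Phi_out yV; apply: filterS H => z ->.
by rewrite (nbhs_singleton (Phi_out yV)) subrr fnorm_ge0.
Qed.

Lemma fdist_ge_truncated eta (alpha : R -> X) a b : `|eta - xi0| < r ->
  a < b -> piecewise_smooth_path alpha a b -> alpha a = inv xi -> alpha b = inv eta ->
  Num.min ((1 - e) * N0 (eta - xi)) rho <= fdist (inv xi) (inv eta).
Proof.
move=> etar ab ps ea eb.
have := fdist_ge ab ps Phi_cont Phi_lip; rewrite ea eb; apply: le_trans.
have r2 : r < 2 * r by rewrite ltr_pMl// ltr1n.
have r3 : r / 2 < 2 * r by lra.
have Vz z : `|z - xi0| < 2 * r -> V (inv z) /\ chart i (inv z) = z.
  move=> zr; have [zi _] := near_img zr; have [h1 h2] := chart_img_inv zi.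
  by split=> //; split; rewrite ?h2.
have [V1 c1] := Vz _ (lt_trans xir r3); have [V2 c2] := Vz _ (lt_trans etar r2).
rewrite (PhiV V1) (PhiV V2) c1 c2 {2}/phi subrr (norm_zero N0n) mulr0.
by rewrite (min_l rho_ge0) subr0.
Qed.

End truncated_distance.

(** The upper bound is the length of the straight segment. For the lower bound, the radius r / (4
    K^2) gives N0 (eta - xi) <= r / (2 K), so that the truncation at [rho] has no effect. *)
Lemma fdist_chart_bounds xi eta :
  `|xi - xi0| < r / 2 -> `|eta - xi0| < r / 2 ->
  `|xi - xi0| < r / (4 * K ^+ 2) -> `|eta - xi0| < r / (4 * K ^+ 2) ->
  (1 - e) * N0 (eta - xi) <= fdist (inv xi) (inv eta) <= (1 + e) * N0 (eta - xi).
Proof.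
move=> x1 y1 x2 y2.
pose alpha := inv \o line xi (eta - xi).
have a0 : alpha 0 = inv xi by rewrite /alpha/= /line scale0r addr0.
have a1 : alpha 1 = inv eta by rewrite /alpha/= /line scale1r addrC subrK.
have exi : `|eta - xi| <= `|eta - xi0| + `|xi - xi0|.
  by rewrite (distrC xi xi0); exact: ler_distD.
have seg t : t \in `[0, 1] -> `|line xi (eta - xi) t - xi0| < 2 * r.
  rewrite in_itv/= => /andP[t0 t1]; rewrite /line addrAC.
  apply: le_lt_trans (ler_normD _ _) _; rewrite normrZ (ger0_norm t0).
  apply: (@le_lt_trans _ _ (`|xi - xi0| + `|eta - xi|)).
    by rewrite lerD2l ler_piMl.
  apply: le_lt_trans (lerD (lexx _) exi) _.
  apply: lt_trans (ltrD x1 (ltrD y1 x1)) _.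
  by move: r0; lra.
have sm : smooth_path alpha 0 1.
  by apply: segment_smooth => t /seg /near_img[].
have ps := piecewise_of_smooth_path ltr01 sm.
apply/andP; split.
  have := fdist_ge_truncated x1 (lt_trans y1 _) ltr01 ps a0 a1.
  rewrite ltr_pdivrMr// ltr_pMr// ltr1n => /(_ isT).
  rewrite min_l// ler_wpM2l ?subr_ge0 ?(ltW e1)//.
  apply: le_trans (N0K _).1 _; rewrite ler_pdivlMr ?mulr_gt0//.
  have : `|eta - xi| <= 2 * (r / (4 * K ^+ 2)) by lra.
  move=> /(ler_wpM2l (ltW K0)) /(ler_wpM2r (_ : 0 <= 2 * K)); rewrite mulr_ge0 ?(ltW K0)//.
  move=> /(_ isT) /le_trans; apply.
  by rewrite le_eqVlt; apply/orP; left; apply/eqP; field; rewrite lt0r_neq0.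
have := fdist_le_length ltr01 ps; rewrite a0 a1 => /le_trans; apply.
have := @segment_length_le R n X i xi (eta - xi) 0 1 ((1 + e) * N0 (eta - xi)) ltr01.
rewrite subr0 mulr1; apply => t /seg h; have [h1 /(_ (eta - xi))/andP[_ h2]] := near_img h.
by split.
Qed.

End metric_in_a_chart.

Lemma fdist_local (R : realType) (n : nat) (X : finsler_manifold R n)
    (i : chart_index X) (x0 : X) (e : R) : chart_dom i x0 -> 0 < e < 1 ->
  exists2 r, 0 < r & forall xi eta : 'rV[R]_n,
    `|xi - chart i x0| < r -> `|eta - chart i x0| < r ->
    (1 - e) * fnorm (finsler X) i x0 (eta - xi)
      <= fdist (chart_inv i xi) (chart_inv i eta)
      <= (1 + e) * fnorm (finsler X) i x0 (eta - xi).
Proof.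
move=> x0i /andP[e0 e1].
have [K K0 HK] := norm_equivalent (fnorm_is_norm x0i) (fnorm_continuous_fiber x0i).
have n1 : nbhs (chart i x0) (chart i @` @chart_dom R n X i).
  by apply: open_nbhs_nbhs; split; [exact: chart_img_open|exists x0].
have ci : {for chart i x0, continuous (@chart_inv R n X i)}.
  by apply: chart_inv_continuous; exists x0.
have n2 := ci _ (_ : nbhs _ _); rewrite chartK// in n2.
have {}n2 := n2 _ (fnorm_near x0i e0).
have [d /= d0 Hd] := (nbhs_ballP _ _).1 (filterI n1 n2).
pose r := d / 2; have r0 : 0 < r by rewrite divr_gt0.
have near_img z : `|z - chart i x0| < 2 * r -> (chart i @` @chart_dom R n X i) z /\
  forall v, (1 - e) * fnorm (finsler X) i x0 v <= fnorm (finsler X) i (chart_inv i z) v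
    <= (1 + e) * fnorm (finsler X) i x0 v.
  rewrite mulrC divfK// distrC => zd.
  by have := Hd z; rewrite -ball_normE/= => /(_ zd).
exists (Num.min (r / 2) (r / (4 * K ^+ 2))).
  by rewrite lt_min !divr_gt0// mulr_gt0// exprn_gt0.
move=> xi eta; rewrite !lt_min => /andP[x1 x2] /andP[y1 y2].
exact: (fdist_chart_bounds x0i e1 r0 K0 near_img HK x1 y1 x2 y2).
Qed.

(** * Isometric embeddings *)

Section minkowski_coordinates.
Variables (R : realType) (p q : nat).
Local Notation I := ('I_p + 'I_q)%type.

Definition mink_coord (l : I) (v : minkowski_space R p q) : R :=
  match l with inl a => pi_plus v ord0 a | inr b => pi_minus v ord0 b end.

Definition mink_sign (l : I) : R := match l with inl _ => 1 | inr _ => -1 end.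

Lemma mink_coordB l u v : mink_coord l (u - v) = mink_coord l u - mink_coord l v.
Proof. by case: l => a; rewrite /mink_coord /pi_plus /pi_minus/= !mxE. Qed.

Lemma norm_mink_sign l : `|mink_sign l| = 1.
Proof. by case: l => a /=; rewrite ?normrN normr1. Qed.

Lemma minkowski_formE v : minkowski_form v v = diag_form mink_sign (mink_coord^~ v).
Proof.
rewrite /minkowski_form /diag_form big_sumType/= -sumrN; congr (_ + _).
  by apply: eq_bigr => a _; rewrite mul1r expr2.
by apply: eq_bigr => a _; rewrite mulN1r expr2.
Qed.

Lemma minkowski_energy_sumE (beta : R -> minkowski_space R p q) (T : R) m :
  minkowski_energy_sum beta 0 T m = \sum_(j < m)
    diag_form mink_sign (fun l => mink_coord l (beta (j%:R * (T / m%:R) + T / m%:R))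
       - mink_coord l (beta (j%:R * (T / m%:R)))) / (T / m%:R).
Proof.
have e1 (k : nat) : 0 + k.+1%:R * ((T - 0) / m%:R) = k%:R * (T / m%:R) + T / m%:R.
  by rewrite -natr1 add0r subr0 mulrDl mul1r.
have e2 (k : nat) : 0 + k%:R * ((T - 0) / m%:R) = k%:R * (T / m%:R) by rewrite add0r subr0.
rewrite /minkowski_energy_sum big_add1 big_mkord; apply: eq_bigr => j _.
rewrite e1 e2 [X in _ / X]addrC addKr minkowski_formE.
by congr (_ / _); apply: eq_bigr => l _; rewrite mink_coordB.
Qed.

(** sg times the form is the sum of squares of sign sg minus the sum of squares of sign -sg, and d l
    ^+ 2 is one term of the latter. *)
Lemma sqr_coord_le (sg : R) (d : I -> R) l : sg ^+ 2 = 1 -> mink_sign l = - sg ->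
  d l ^+ 2 <= \sum_(l' | mink_sign l' == sg) d l' ^+ 2 - sg * diag_form mink_sign d.
Proof.
move=> sg1 ls; rewrite /diag_form mulr_sumr [X in _ - X](bigID (fun l' => mink_sign l' == sg))/=.
have sg0 : sg != 0 by apply: contra_eq_neq sg1 => ->; rewrite expr0n/= eq_sym oner_neq0.
have -> : \sum_(l' | mink_sign l' == sg) sg * (mink_sign l' * d l' ^+ 2) =
  \sum_(l' | mink_sign l' == sg) d l' ^+ 2.
  by apply: eq_bigr => l' /eqP ->; rewrite mulrA -expr2 sg1 mul1r.
rewrite opprD addNKr -sumrN (bigD1 l)/=; last first.
  by rewrite ls -subr_eq0 -opprD oppr_eq0 -mulr2n mulrn_eq0/=.
rewrite ls mulNr mulrN opprK mulrA -expr2 sg1 mul1r lerDl.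
apply: sumr_ge0 => l' /andP[ll' _].
have -> : mink_sign l' = - sg.
  have : mink_sign l' ^+ 2 = 1 by case: (l') => a; rewrite /= ?sqrrN expr1n.
  rewrite -sg1 => /eqP; rewrite eqf_sqr => /orP[/eqP E|/eqP//].
  by rewrite E eqxx in ll'.
by rewrite mulNr mulrN opprK mulrA -expr2 sg1 mul1r sqr_ge0.
Qed.

End minkowski_coordinates.

Lemma sqr_sum_le (R : realType) (m : nat) (u : nat -> R) :
  (\sum_(j < m) u j) ^+ 2 <= m%:R * \sum_(j < m) u j ^+ 2.
Proof.
elim: m => [|m IH]; first by rewrite !big_ord0 expr0n mul0r.
rewrite !big_ord_recr/=; move: IH.
set x := u m; set S := \sum_(j < m) _; set Q := \sum_(j < m) _ => IH.
suff h : 2 * S * x <= Q + m%:R * x ^+ 2.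
  rewrite -natr1; move: h IH; lra.
have -> : Q + m%:R * x ^+ 2 = \sum_(j < m) (u j ^+ 2 + x ^+ 2).
  by rewrite big_split/= sumr_const card_ord mulr_natl.
have -> : 2 * S * x = \sum_(j < m) (2 * u j * x) by rewrite -mulr_suml -mulr_sumr.
by apply: ler_sum => j _; have := sqr_ge0 (u j - x); lra.
Qed.

Section path_energy.
Variables (R : realType) (n : nat) (X : finsler_manifold R n).

(** The subdivision into a single interval gives the lower bound; the upper bound holds term by term
    and telescopes. *)
Lemma energy_bounds (alpha : R -> X) (a b A B E : R) : a < b -> 0 <= A ->
  (forall s t, a <= s -> s <= t -> t <= b -> fdist (alpha s) (alpha t) <= B * (t - s)) ->
  (forall s t, 0 <= fdist (alpha s) (alpha t)) ->
  A * (b - a) <= fdist (alpha a) (alpha b) ->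
  energy alpha a b = E%:E -> A ^+ 2 * (b - a) <= E <= B ^+ 2 * (b - a).
Proof.
move=> ab A0 hB d0 hA EE.
have ba : 0 < b - a by rewrite subr_gt0.
apply/andP; split; rewrite -lee_fin -EE.
  apply: (@le_trans _ _ (fdist (alpha a) (alpha b) ^+ 2 / (b - a))%:E); last first.
    apply: ereal_sup_ubound; exists [:: b]; first exact: itv_partition1.
    by rewrite /= big_nat1.
  rewrite lee_fin ler_pdivlMr//.
  have := ler_pM (mulr_ge0 A0 (ltW ba)) (mulr_ge0 A0 (ltW ba)) hA hA.
  rewrite -!expr2; lra.
apply: ge_ereal_sup => _ [s ps ->]; rewrite lee_fin.
have [pths /eqP lst] := ps.
have -> : b - a = \sum_(0 <= k < size s) (nth b (a :: s) k.+1 - nth b (a :: s) k).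
  by rewrite telescope_sumr// (itv_partition_nth_size b ps).
rewrite mulr_sumr !big_nat; apply: ler_sum => k /andP[_ ks] /=.
have lt : nth b (a :: s) k < nth b s k by have /(pathP b)/(_ k ks) := pths.
have d := hB _ _ (itv_partition_nth_ge (m := k) (ltnW ks) ps) (ltW lt)
  (itv_partition_nth_le (m := k.+1) ks ps).
rewrite ler_pdivrMr ?subr_gt0//.
have := ler_pM (d0 _ _) (d0 _ _) d d; rewrite -!expr2 /=; lra.
Qed.

Lemma fdist_ge0 (x y : X) : 0 <= fdist x y.
Proof.
rewrite /fdist; set S := (X in inf X).
have [->|/set0P S0] := eqVneq S set0; first by rewrite inf0.
apply: lb_le_inf => // l [a [b [al [_ _ _ _ ->]]]].
exact: path_length_ge0.
Qed.

End path_energy.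

Section embedding_in_a_chart.
Variables (R : realType) (n p q : nat) (X : finsler_manifold R n).
Variables (f : X -> minkowski_space R p q) (i : chart_index X) (x0 : X).
Hypothesis x0i : chart_dom i x0.
Hypothesis f_emb : path_isometric_embedding f.
Local Notation inv := (@chart_inv R n X i).
Local Notation N0 := (fnorm (finsler X) i x0).
Local Notation xi0 := (chart i x0).
Local Notation I := ('I_p + 'I_q)%type.

Let N0n := fnorm_is_norm x0i.

Definition embedding_coord (l : I) (z : 'rV[R]_n) : R := mink_coord l (f (inv z)).
Local Notation F := embedding_coord.

Section bounds.
Variables (e r : R).
Hypothesis e1 : e < 1.
Hypothesis fdist_bounds : forall xi eta : 'rV[R]_n,
  `|xi - xi0| < r -> `|eta - xi0| < r ->
  (1 - e) * N0 (eta - xi) <= fdist (inv xi) (inv eta) <= (1 + e) * N0 (eta - xi).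

(** The bounds on [fdist] make the segment a Lipschitz path of almost constant speed, so the
    embedding transports the estimate of [energy_bounds] to its image. *)
Lemma segment_energy (xi w : 'rV[R]_n) (T : R) : 0 < T ->
  (forall t, 0 <= t <= T -> `|line xi w t - xi0| < r) ->
  exists2 E, minkowski_energy_sum (f \o (inv \o line xi w)) 0 T @ \oo --> E &
    (1 - e) ^+ 2 * N0 w ^+ 2 * T <= E <= (1 + e) ^+ 2 * N0 w ^+ 2 * T.
Proof.
move=> T0 seg.
have lineB s t : line xi w t - line xi w s = (t - s) *: w.
  by rewrite /line opprD addrACA subrr add0r scalerBl.
have bnd s t : 0 <= s -> s <= t -> t <= T ->
    (1 - e) * N0 w * (t - s) <= fdist (inv (line xi w s)) (inv (line xi w t))
      <= (1 + e) * N0 w * (t - s).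
  move=> s0 st tT.
  have := @fdist_bounds (line xi w s) (line xi w t) (seg s _) (seg t _).
  rewrite s0 (le_trans st tT) (le_trans s0 st) tT => /(_ isT isT).
  rewrite lineB (norm_scale N0n) ger0_norm ?subr_ge0// => /andP[h1 h2].
  by apply/andP; split; lra.
have lip : lipschitz_path (inv \o line xi w) 0 T.
  exists ((1 + e) * N0 w) => s t; rewrite !in_itv/= => /andP[s0 sT] /andP[t0 tT].
  have := @fdist_bounds (line xi w s) (line xi w t) (seg s _) (seg t _).
  rewrite s0 sT t0 tT => /(_ isT isT) /andP[_].
  by rewrite lineB (norm_scale N0n) distrC mulrA; lra.
have [E HE EE] := f_emb.2 0 T (inv \o line xi w) T0 lip.
exists E => //.
have := @energy_bounds _ _ _ (inv \o line xi w) 0 T ((1 - e) * N0 w) ((1 + e) * N0 w) E T0.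
rewrite subr0 !exprMn; apply => //.
- by rewrite mulr_ge0 ?(norm_ge0 N0n)// subr_ge0 ltW.
- by move=> s t s0 st tT; have /andP[] := bnd s t s0 st tT.
- by move=> s t; exact: fdist_ge0.
- by have := bnd 0 T (lexx _) (ltW T0) (lexx _); rewrite subr0 => /andP[].
Qed.

End bounds.

(* The energy of the image of a segment is bounded, so by Cauchy-Schwarz the
   coordinates of one sign are Lipschitz as soon as those of the other sign are. *)
Lemma other_coord_lipschitz (sg C r : R) : sg ^+ 2 = 1 -> 0 <= C ->
  (forall xi eta : 'rV[R]_n, `|xi - xi0| < r -> `|eta - xi0| < r ->
    (1 - 2^-1) * N0 (eta - xi) <= fdist (inv xi) (inv eta) <= (1 + 2^-1) * N0 (eta - xi)) ->
  (forall l xi eta, mink_sign R l = sg -> `|xi - xi0| < r -> `|eta - xi0| < r ->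
    `|F l eta - F l xi| <= C * N0 (eta - xi)) ->
  forall l xi eta, `|xi - xi0| < r / 3 -> `|eta - xi0| < r / 3 ->
    `|F l eta - F l xi| <= (C + #|{: I}|%:R * C ^+ 2 + 4) * N0 (eta - xi).
Proof.
move=> sg1 C0 hd hC l xi eta xr er.
have N00 := norm_ge0 N0n (eta - xi).
have D0 : 0 <= #|{: I}|%:R * C ^+ 2 + 4 by rewrite addr_ge0// mulr_ge0// sqr_ge0.
have r0 : 0 < r by have := le_lt_trans (normr_ge0 _) xr; rewrite pmulr_lgt0 ?invr_gt0.
have [ls|ls] := eqVneq (mink_sign R l) sg.
  apply: le_trans (hC l xi eta ls _ _) _.
  - by apply: lt_trans xr _; rewrite ltr_pdivrMr// ltr_pMr// ltr1n.
  - by apply: lt_trans er _; rewrite ltr_pdivrMr// ltr_pMr// ltr1n.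
  - by rewrite ler_wpM2r// -addrA lerDl.
have {}ls : mink_sign R l = - sg.
  have : mink_sign R l ^+ 2 = 1 by case: (l) => a; rewrite /= ?sqrrN expr1n.
  by rewrite -sg1 => /eqP; rewrite eqf_sqr (negbTE ls) => /eqP.
set w := eta - xi; set D := #|{: I}|%:R * C ^+ 2 + 4.
(* The distance to the centre is at most |xi - xi0| + |eta - xi|, hence less than three times r /
   3. *)
have seg t : 0 <= t <= 1 -> `|line xi w t - xi0| < r.
  move=> /andP[t0 t1]; rewrite /line addrAC.
  apply: le_lt_trans (ler_normD _ _) _; rewrite normrZ (ger0_norm t0).
  have h1 : t * `|w| <= `|w| by rewrite ler_piMl.
  have h2 : `|w| <= `|eta - xi0| + `|xi - xi0|.
    by rewrite (distrC xi xi0); exact: ler_distD.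
  apply: le_lt_trans (lerD (lexx _) (le_trans h1 h2)) _.
  by apply: lt_le_trans (ltrD xr (ltrD er xr)) _; lra.
have hl1 : 2^-1 < 1 :> R by rewrite invf_lt1// ltr1n.
have [E HE /andP[Elo Ehi]] := segment_energy hl1 hd ltr01 seg.
rewrite mulr1 in Elo; rewrite mulr1 in Ehi.
pose beta := f \o (inv \o line xi w).
have lineB s t : line xi w t - line xi w s = (t - s) *: w.
  by rewrite /line opprD addrACA subrr add0r scalerBl.
(* Over m steps of length h = 1 / m, Cauchy-Schwarz bounds the square of the total increment by the
   sum of the squared increments divided by h, which is an energy sum. *)
have key m : (0 < m)%N -> (F l eta - F l xi) ^+ 2 <=
    #|{: I}|%:R * C ^+ 2 * N0 w ^+ 2 - sg * minkowski_energy_sum beta 0 1 m.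
  move=> m0; pose h : R := 1 / m%:R.
  have mR : 0 < m%:R :> R by rewrite ltr0n.
  have h0 : 0 < h by rewrite divr_gt0.
  have mh : m%:R * h = 1 by rewrite /h mulrCA divff ?mulr1// lt0r_neq0.
  pose d (j : nat) (l' : I) :=
    mink_coord l' (beta (j%:R * h + h)) - mink_coord l' (beta (j%:R * h)).
  have -> : F l eta - F l xi = \sum_(j < m) d j l.
    rewrite -(big_mkord xpredT (fun j => d j l)).
    rewrite (eq_bigr (fun j => mink_coord l (beta (j.+1%:R * h)) - mink_coord l (beta (j%:R * h))));
      last by move=> j _; rewrite /d -natr1 mulrDl mul1r.
    rewrite (telescope_sumr (fun j => mink_coord l (beta (j%:R * h))))// mh mul0r.
    have xw : xi + w = eta by rewrite /w addrC subrK.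
    by rewrite /beta/= /line scale1r scale0r addr0 xw.
  apply: le_trans (sqr_sum_le m (fun j => d j l)) _.
  have pt j : (j <= m)%N -> 0 <= j%:R * h <= 1.
    move=> jm; apply/andP; split; first by rewrite mulr_ge0// ltW.
    by rewrite -[leRHS]mh ler_wpM2r ?(ltW h0)// ler_nat.
  have dC j l' : (j < m)%N -> mink_sign R l' = sg -> d j l' ^+ 2 <= (C * N0 w * h) ^+ 2.
    move=> jm ls'.
    have jh1 : 0 <= j%:R * h + h <= 1.
      by rewrite (_ : j%:R * h + h = j.+1%:R * h) ?pt// -natr1 mulrDl mul1r.
    have H := hC l' _ _ ls' (seg _ (pt j (ltnW jm))) (seg _ jh1).
    rewrite lineB (norm_scale N0n) [X in `|X| * N0 w]addrC addKr (ger0_norm (ltW h0)) in H.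
    rewrite -real_normK ?num_real//.
    have := ler_pM (normr_ge0 _) (normr_ge0 _) H H; rewrite -!expr2 /F /d /beta/=; lra.
  have step j : (j < m)%N -> d j l ^+ 2 <=
      #|{: I}|%:R * (C * N0 w * h) ^+ 2 - sg * diag_form (@mink_sign R p q) (d j).
    move=> jm; apply: le_trans (sqr_coord_le (d j) sg1 ls) _; rewrite lerD2r.
    apply: (@le_trans _ _ (\sum_(l' | mink_sign R l' == sg) (C * N0 w * h) ^+ 2)).
      by apply: ler_sum => l' /eqP ls'; exact: dC.
    by rewrite sumr_const -[leLHS]mulr_natl ler_wpM2r ?sqr_ge0// ler_nat max_card.
  apply: (@le_trans _ _ (m%:R * \sum_(j < m)
     (#|{: I}|%:R * (C * N0 w * h) ^+ 2 - sg * diag_form (@mink_sign R p q) (d j)))).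
    by rewrite ler_wpM2l ?(ltW mR)//; apply: ler_sum => j _; exact: step.
  rewrite sumrB sumr_const card_ord minkowski_energy_sumE mulrBr.
  rewrite -mulr_sumr; apply: lerB.
    have -> : m%:R * ((#|{: I}|%:R * (C * N0 w * h) ^+ 2) *+ m) =
      #|{: I}|%:R * C ^+ 2 * N0 w ^+ 2 * (m%:R * h) ^+ 2 by ring.
    by rewrite mh expr1n mulr1.
  rewrite mulrCA le_eqVlt; apply/orP; left; apply/eqP; congr (sg * _).
  rewrite mulr_sumr; apply: eq_bigr => j _.
  by rewrite [X in _ / X]div1r invrK mulrC.
have fin : (F l eta - F l xi) ^+ 2 <= #|{: I}|%:R * C ^+ 2 * N0 w ^+ 2 - sg * E.
  apply/ler_addgt0Pr => z z0.
  have /cvgrPdist_le/(_ z z0) := HE; move=> [m0 _ Hm].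
  have := Hm m0.+1 (leqnSn m0); rewrite -/beta => Em.
  apply: le_trans (key m0.+1 _) _ => //.
  have : sg * (E - minkowski_energy_sum beta 0 1 m0.+1) <= z.
    apply: le_trans (ler_norm _) _; rewrite normrM.
    have -> : `|sg| = 1 by apply/eqP; rewrite -sqrp_eq1// real_normK ?num_real// sg1.
    by rewrite mul1r.
  lra.
have A0 : 0 <= #|{: I}|%:R * C ^+ 2 by rewrite mulr_ge0// sqr_ge0.
have D1 : 1 <= D by rewrite /D; lra.
have W0 := sqr_ge0 (N0 w).
have E0 : 0 <= E by apply: le_trans Elo; rewrite mulr_ge0// sqr_ge0.
(* (1 + 1/2)^2 = 9/4 <= 4. *)
have sE : - (sg * E) <= 4 * N0 w ^+ 2.
  apply: le_trans (ler_norm _) _; rewrite normrN normrM.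
  have -> : `|sg| = 1 by apply/eqP; rewrite -sqrp_eq1// real_normK ?num_real// sg1.
  by rewrite mul1r ger0_norm//; apply: le_trans Ehi _; lra.
(* D >= 1 replaces D by D^2, so that no square root enters the Lipschitz constant. *)
have h : (F l eta - F l xi) ^+ 2 <= (D * N0 w) ^+ 2.
  apply: (@le_trans _ _ (D * N0 w ^+ 2)); first by rewrite /D; lra.
  by rewrite exprMn ler_wpM2r// expr2 ler_peMr// (le_trans ler01).
apply: (@le_trans _ _ (D * N0 w)); last by rewrite ler_wpM2r// /D -addrA lerDr.
rewrite -(@ler_pXn2r _ 2) ?nnegrE ?normr_ge0//; last by rewrite mulr_ge0// (le_trans ler01).
by rewrite real_normK ?num_real.
Qed.

End embedding_in_a_chart.

(* Clamping the parameters makes the coordinate functions globally Lipschitz without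
   changing them on the lines that matter. *)
Definition clamp (R : realType) (x : R) : R := Num.max (- 3) (Num.min x 3).

Lemma clamp_id (R : realType) (x : R) : - 3 <= x -> x <= 3 -> clamp x = x.
Proof. by move=> h1 h2; rewrite /clamp (min_l h2) max_r. Qed.

Lemma clamp_bound (R : realType) (x : R) : `|clamp x| <= 3.
Proof.
rewrite /clamp ler_norml; case: (leP x 3) => h; rewrite le_max ge_max ?lexx/=; apply/andP;
  split; try lra.
Qed.

Lemma clamp_lip (R : realType) (x y : R) : `|clamp x - clamp y| <= `|x - y|.
Proof.
have h1 := ler_norm (x - y); have h2 := ler_norm (y - x); rewrite distrC in h2.
have h3 := normr_ge0 (x - y); rewrite ler_norml /clamp.
case: (leP x 3) => a1; case: (leP y 3) => a2; case: (leP (- 3) x) => a3;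
  case: (leP (- 3) y) => a4; case: (leP (- 3 : R) 3) => a5; apply/andP; split; lra.
Qed.

(** * The third difference identity for the norm at a point *)

Section third_difference_vanishes.
Variables (R : realType) (n p q : nat) (X : finsler_manifold R n).
Variables (f : X -> minkowski_space R p q) (i : chart_index X) (x0 : X).
Hypothesis x0i : chart_dom i x0.
Hypothesis f_emb : path_isometric_embedding f.
Local Notation inv := (@chart_inv R n X i).
Local Notation N0 := (fnorm (finsler X) i x0).
Local Notation xi0 := (chart i x0).
Local Notation I := ('I_p + 'I_q)%type.
Local Notation F := (embedding_coord f i).

Let N0n := fnorm_is_norm x0i.

Variables (r1 L : R).
Hypotheses (r10 : 0 < r1) (L0 : 0 <= L).
Hypothesis F_lip : forall (l : I) xi eta, `|xi - xi0| < r1 -> `|eta - xi0| < r1 ->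
  `|F l eta - F l xi| <= L * N0 (eta - xi).

Variables y z : 'rV[R]_n.

Let c (k : R) := N0 (y + k *: z) ^+ 2.

Section fixed_scale.
Variables (e r rho del : R).
Hypotheses (e0 : 0 < e) (e1 : e < 1) (rho0 : 0 < rho) (del0 : 0 < del) (del1 : del <= 1).
Hypothesis fdist_bounds : forall xi eta : 'rV[R]_n,
  `|xi - xi0| < r -> `|eta - xi0| < r ->
  (1 - e) * N0 (eta - xi) <= fdist (inv xi) (inv eta) <= (1 + e) * N0 (eta - xi).
Hypotheses (rho_r : rho * (3 * (`|z| + `|y|)) < r) (rho_r1 : rho * (3 * (`|z| + `|y|)) < r1).

Let pt (s t : R) : 'rV[R]_n := xi0 + rho *: (s *: z + t *: y).

(** Division by [rho] makes the Lipschitz constant independent of the scale, so the final error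
    depends on [del] and e only. *)
Let G (l : I) (s t : R) : R := F l (pt (clamp s) (clamp t)) / rho.

Let pt_near s t b : `|s| <= 3 -> `|t| <= 3 -> rho * (3 * (`|z| + `|y|)) < b ->
  `|pt s t - xi0| < b.
Proof.
move=> s3 t3; apply: le_lt_trans; rewrite /pt addrC addKr normrZ (ger0_norm (ltW rho0)).
rewrite ler_pM2l//; apply: le_trans (ler_normD _ _) _; rewrite !normrZ mulrDr.
by rewrite lerD// ler_wpM2r.
Qed.

Let G_lip l s t s' t' :
  `|G l s t - G l s' t'| <= L * (N0 z + N0 y) * (`|s - s'| + `|t - t'|).
Proof.
rewrite /G -mulrBl normrM normfV (ger0_norm (ltW rho0)) ler_pdivrMr//.
apply: le_trans (F_lip _ _ _) _; try by apply: pt_near => //; exact: clamp_bound.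
have -> : pt (clamp s) (clamp t) - pt (clamp s') (clamp t') =
    rho *: ((clamp s - clamp s') *: z + (clamp t - clamp t') *: y).
  rewrite /pt opprD addrACA subrr add0r -scalerBr opprD addrACA.
  by rewrite -!scalerBl.
rewrite (norm_scale N0n) (ger0_norm (ltW rho0)).
have h := norm_add N0n ((clamp s - clamp s') *: z) ((clamp t - clamp t') *: y).
rewrite !(norm_scale N0n) in h.
have z0 := norm_ge0 N0n z; have y0 := norm_ge0 N0n y.
have h1 : `|clamp s - clamp s'| * N0 z <= `|s - s'| * N0 z by rewrite ler_wpM2r ?clamp_lip.
have h2 : `|clamp t - clamp t'| * N0 y <= `|t - t'| * N0 y by rewrite ler_wpM2r ?clamp_lip.
rewrite -!mulrA ler_wpM2l// mulrA [leRHS]mulrC ler_pM2l//.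
have := mulr_ge0 (normr_ge0 (s - s')) y0; have := mulr_ge0 (normr_ge0 (t - t')) z0.
lra.
Qed.

Let pt_line s k t : line (pt s 0) (rho *: (y + k *: z)) t = pt (s + k * t) t.
Proof.
rewrite /pt /line scale0r addr0 -addrA; congr (_ + _).
have -> : t *: (rho *: (y + k *: z)) = rho *: (t *: (y + k *: z)).
  by rewrite !scalerA mulrC.
rewrite -scalerDr; congr (_ *: _).
by rewrite scalerDr scalerA (mulrC t) scalerDl -addrA [X in _ + X]addrC.
Qed.

(** Here s + k t lies in [-1, 3], where [clamp] is the identity. *)
Let GE l s k t : 0 <= s <= 1 -> k <= 2 -> -1 <= k -> 0 <= t <= 1 ->
  G l (s + k * t) t = F l (line (pt s 0) (rho *: (y + k *: z)) t) / rho.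
Proof.
move=> /andP[s0 s1] k2 k1 /andP[t0 t1].
have kt1 : k * t <= 2 * t by rewrite ler_wpM2r.
have kt2 : -1 * t <= k * t by rewrite ler_wpM2r.
by rewrite /G !clamp_id ?pt_line//; lra.
Qed.

Let line_energyE k K s : 0 <= s <= 1 -> k <= 2 -> -1 <= k ->
  line_energy (@mink_sign R p q) G del k K s =
  minkowski_energy_sum (f \o (inv \o line (pt s 0) (rho *: (y + k *: z)))) 0 del (2 ^ K)
    / rho ^+ 2.
Proof.
move=> s01 k2 k1; rewrite minkowski_energy_sumE /line_energy natrX mulr_suml.
set H := del / 2 ^+ K.
have H0 : 0 < H by rewrite divr_gt0// exprn_gt0.
have HK : (2 ^ K)%:R * H = del by rewrite natrX /H mulrC divfK// expf_neq0.
have k22 : `|k| <= 2 by rewrite ler_norml; apply/andP; split; lra.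
apply: eq_bigr => j _.
have jH0 : 0 <= j%:R * H by rewrite mulr_ge0// ltW.
have jH1 : j%:R * H + H <= 1.
  apply: le_trans del1; rewrite -[leRHS]HK -[X in _ + X]mul1r -mulrDl natr1.
  by rewrite ler_wpM2r ?(ltW H0)// ler_nat.
have j1 : 0 <= j%:R * H + H <= 1 by rewrite jH1 addr_ge0// ltW.
have j0 : 0 <= j%:R * H <= 1.
  by rewrite jH0 (le_trans _ jH1)// lerDl ltW.
rewrite [RHS]mulrAC; congr (_ / H); rewrite /diag_form mulr_suml.
apply: eq_bigr => l _; rewrite -mulrA; congr (_ * _).
have e1' : s + k * (j%:R * H) + k * H = s + k * (j%:R * H + H) by ring.
by rewrite e1' !GE// -mulrBl expr_div_n.
Qed.

(** For 0 < e < 1 the factors (1 - e)^2 and (1 + e)^2 lie between 1 - 3 e and 1 + 3 e. The sum of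
    the four values of c bounds each of them and gives one error valid for all four slopes. *)
Lemma third_difference_small :
  `|c 2 - 3 * c 1 + 3 * c 0 - c (-1)| <=
    8 * (3 * e * (c 2 + c 1 + c 0 + c (-1)))
    + 2016 * #|{: I}|%:R * (L * (N0 z + N0 y)) ^+ 2 * del.
Proof.
have sgn1 (l : I) : `|mink_sign R l| <= 1 by rewrite norm_mink_sign.
have L'0 : 0 <= L * (N0 z + N0 y) by rewrite mulr_ge0// addr_ge0// (norm_ge0 N0n).
apply: (third_difference_bound sgn1 L'0 G_lip del0) => k s kin s01.
have [k1 k2] : -1 <= k /\ k <= 2.
  by move: kin; rewrite !inE => /or4P[] /eqP ->; split; lra.
have k22 : `|k| <= 2 by rewrite ler_norml; apply/andP; split; lra.
have c0 k' : 0 <= c k' by exact: sqr_ge0.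
have ck : c k <= c 2 + c 1 + c 0 + c (-1).
  have := c0 2; have := c0 1; have := c0 0; have := c0 (-1).
  by move: kin; rewrite !inE => /or4P[] /eqP ->; lra.
have seg t : 0 <= t <= del -> `|line (pt s 0) (rho *: (y + k *: z)) t - xi0| < r.
  move=> /andP[t0 td]; have t1 := le_trans td del1.
  rewrite pt_line.
  have /andP[s0 s1] := s01.
  have kt1 : k * t <= 2 * t by rewrite ler_wpM2r.
  have kt2 : -1 * t <= k * t by rewrite ler_wpM2r.
  by apply: pt_near => //; rewrite ler_norml; apply/andP; split; lra.
have [E HE /andP[E1 E2]] := segment_energy x0i f_emb e1 fdist_bounds del0 seg.
exists (E / rho ^+ 2).
  under eq_fun do rewrite line_energyE//.
  apply: cvgMl; apply: cvg_comp HE.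
  (* The dyadic sums are the subsequence m = 2 ^ K of the energy sums, and K < 2 ^ K. *)
  move=> A [N _ NA]; exists N => // K /= NK; apply: NA => /=.
  by apply: leq_trans NK _; exact/ltnW/ltn_expl.
rewrite (norm_scale N0n) (ger0_norm (ltW rho0)) exprMn in E1 E2.
have r2 : 0 < rho ^+ 2 by rewrite exprn_gt0.
have ck0 := c0 k.
have cd0 : 0 <= c k * del by rewrite mulr_ge0// ltW.
have cd1 : e * (c k * del) <= e * ((c 2 + c 1 + c 0 + c (-1)) * del).
  by rewrite ler_wpM2l ?(ltW e0)// ler_wpM2r ?(ltW del0).
have b1 : (1 - e) ^+ 2 * (c k * del) <= E / rho ^+ 2.
  by rewrite ler_pdivlMr//; move: E1; rewrite /c; lra.
have b2 : E / rho ^+ 2 <= (1 + e) ^+ 2 * (c k * del).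
  by rewrite ler_pdivrMr//; move: E2; rewrite /c; lra.
have b3 : (1 + e) ^+ 2 * (c k * del) <= (1 + 3 * e) * (c k * del).
  rewrite ler_wpM2r//; have := mulr_ge0 (ltW e0) (_ : 0 <= 1 - e).
  rewrite subr_ge0 (ltW e1) => /(_ isT); lra.
have b4 : (1 - 3 * e) * (c k * del) <= (1 - e) ^+ 2 * (c k * del).
  by rewrite ler_wpM2r//; have := sqr_ge0 e; move: e0; lra.
rewrite ler_norml; apply/andP; split; lra.
Qed.

End fixed_scale.

Lemma third_difference_vanishes :
  N0 (y + z + z) ^+ 2 - 3 * N0 (y + z) ^+ 2 + 3 * N0 y ^+ 2 - N0 (y - z) ^+ 2 = 0.
Proof.
have -> : N0 (y + z + z) ^+ 2 - 3 * N0 (y + z) ^+ 2 + 3 * N0 y ^+ 2 - N0 (y - z) ^+ 2 =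
    c 2 - 3 * c 1 + 3 * c 0 - c (-1).
  by rewrite /c scale1r scale0r addr0 scaleN1r scaler_nat mulr2n addrA.
pose M := c 2 + c 1 + c 0 + c (-1).
pose B := 24 * M + 2016 * #|{: I}|%:R * (L * (N0 z + N0 y)) ^+ 2.
have M0 : 0 <= M by rewrite /M !addr_ge0// sqr_ge0.
have B0 : 0 <= B.
  apply: addr_ge0; first by apply: mulr_ge0; [exact: ler0n|].
  by apply: mulr_ge0; [apply: mulr_ge0; exact: ler0n|exact: sqr_ge0].
have small e : 0 < e -> e < 1 -> `|c 2 - 3 * c 1 + 3 * c 0 - c (-1)| <= B * e.
  move=> e0 e1.
  have [r r0 hr] := fdist_local x0i (introT andP (conj e0 e1)).
  pose S := 3 * (`|z| + `|y|); have S0 : 0 <= S by rewrite mulr_ge0// addr_ge0.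
  pose rho := Num.min r r1 / (S + 1).
  have m0 : 0 < Num.min r r1 by rewrite lt_min r0 r10.
  have rho0 : 0 < rho by rewrite divr_gt0// ltr_wpDl.
  have rhoS : rho * S < Num.min r r1.
    rewrite /rho mulrAC ltr_pdivrMr ?ltr_wpDl// ltr_pM2l// ltrDl//.
  have := rhoS; rewrite lt_min => /andP[h1 h2].
  (* [del] is taken equal to e, which makes both errors multiples of e. *)
  apply: le_trans (third_difference_small e0 e1 rho0 e0 (ltW e1) hr h1 h2) _.
  by rewrite -/M /B; lra.
apply/normr0_eq0/eqP; rewrite eq_le normr_ge0 andbT.
apply/ler_addgt0Pr => d d0; rewrite add0r.
pose e := Num.min 2^-1 (d / (B + 1)).
have B1 : 0 < B + 1 by rewrite ltr_wpDl.
have e0 : 0 < e by rewrite lt_min invr_gt0 ltr0n divr_gt0.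
have e1 : e < 1 by rewrite gt_min invf_lt1// ltr1n.
apply: le_trans (small e e0 e1) _.
have : e <= d / (B + 1) by rewrite ge_min lexx orbT.
rewrite ler_pdivlMr// => h; move: h e0; lra.
Qed.

End third_difference_vanishes.

Lemma coord_le_euclidean_dist (R : realType) (m : nat) (x y : 'rV[R]_m) (a : 'I_m) :
  `|x ord0 a - y ord0 a| <= euclidean_dist x y.
Proof.
rewrite -sqrtr_sqr; apply: ler_wsqrtr; rewrite (bigD1 a)//= lerDl.
by apply: sumr_ge0 => j _; exact: sqr_ge0.
Qed.

Section one_sign_lipschitz.
Variables (R : realType) (n p q : nat) (X : finsler_manifold R n).
Variables (f : X -> minkowski_space R p q).
Hypothesis f_emb : path_isometric_embedding f.
Variable sg : R.
Hypothesis sg1 : sg ^+ 2 = 1.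
Hypothesis f_lip : forall x : X, exists2 U, nbhs x U & exists C : R,
  forall l y z, mink_sign R l = sg -> U y -> U z ->
    `|mink_coord l (f y) - mink_coord l (f z)| <= C * fdist y z.

Lemma coords_lipschitz (i : chart_index X) x0 : chart_dom i x0 ->
  exists r L : R, [/\ 0 < r, 0 <= L & forall (l : 'I_p + 'I_q) xi eta,
    `|xi - chart i x0| < r -> `|eta - chart i x0| < r ->
    `|embedding_coord f i l eta - embedding_coord f i l xi|
      <= L * fnorm (finsler X) i x0 (eta - xi)].
Proof.
move=> x0i; have N0n := fnorm_is_norm x0i.
have [U xU [C HC]] := f_lip x0.
(* A rough comparison of [fdist] with the norm is enough for a Lipschitz bound; the factor 3/2 is
   absorbed in the constant 2 |C| below. *)
have h2 : 0 < (2^-1 : R) < 1 by rewrite invr_gt0 ltr0n invf_lt1 ?ltr1n// ltr0n.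
have [r r0 hr] := fdist_local x0i h2.
have ci : {for chart i x0, continuous (@chart_inv R n X i)}.
  by apply: chart_inv_continuous; exists x0.
have nU : nbhs (chart i x0) (@chart_inv R n X i @^-1` U).
  by apply: ci; rewrite chartK.
have [d /= d0 Hd] := (nbhs_ballP _ _).1 nU.
have UP z : `|z - chart i x0| < d -> U (chart_inv i z).
  by rewrite distrC => zd; apply: (Hd z); rewrite -ball_normE.
pose s := Num.min r d; have s0 : 0 < s by rewrite lt_min r0.
have lip : forall (l : 'I_p + 'I_q) xi eta, mink_sign R l = sg ->
    `|xi - chart i x0| < s -> `|eta - chart i x0| < s ->
    `|embedding_coord f i l eta - embedding_coord f i l xi|
      <= (2 * `|C|) * fnorm (finsler X) i x0 (eta - xi).
  move=> l xi eta ls; rewrite !lt_min => /andP[x1 x2] /andP[y1 y2].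
  rewrite distrC; apply: le_trans (HC l _ _ ls (UP _ x2) (UP _ y2)) _.
  have /andP[_ h] := hr _ _ x1 y1.
  have N0 := norm_ge0 N0n (eta - xi).
  apply: (@le_trans _ _ (`|C| * fdist (chart_inv i xi) (chart_inv i eta))).
    by rewrite ler_wpM2r ?ler_norm// fdist_ge0.
  rewrite mulrAC [leRHS]mulrC ler_wpM2l//; apply: le_trans h _; lra.
have hs : forall xi eta : 'rV[R]_n, `|xi - chart i x0| < s -> `|eta - chart i x0| < s ->
    (1 - 2^-1) * fnorm (finsler X) i x0 (eta - xi)
      <= fdist (chart_inv i xi) (chart_inv i eta)
      <= (1 + 2^-1) * fnorm (finsler X) i x0 (eta - xi).
  move=> xi eta; rewrite !lt_min => /andP[x1 _] /andP[y1 _]; exact: hr.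
have C0 : 0 <= 2 * `|C| by rewrite mulr_ge0.
exists (s / 3), (2 * `|C| + #|{: 'I_p + 'I_q}|%:R * (2 * `|C|) ^+ 2 + 4); split.
- by rewrite divr_gt0.
- by rewrite !addr_ge0// mulr_ge0// sqr_ge0.
- exact: (other_coord_lipschitz x0i f_emb sg1 C0 hs lip).
Qed.

Lemma riemannian_of_lipschitz_part : riemannian X.
Proof.
move=> i x xi; have [r [L [r0 L0 hL]]] := coords_lipschitz xi.
apply: inner_product_of_third_difference; first exact: fnorm_is_norm.
by move=> y z; exact: (third_difference_vanishes xi f_emb r0 L0 hL).
Qed.

End one_sign_lipschitz.

Theorem proposition1 (R : realType) (n p q : nat) (X : finsler_manifold R n)
    (f : X -> minkowski_space R p q) :
  ~ riemannian X ->
  path_isometric_embedding f ->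
  [/\ (0 < p)%N, (0 < q)%N,
      ~ locally_lipschitz (@pi_plus R p q \o f) &
      ~ locally_lipschitz (@pi_minus R p q \o f)].
Proof.
move=> nR f_emb.
have plus : ~ locally_lipschitz (@pi_plus R p q \o f).
  move=> H; apply/nR/(@riemannian_of_lipschitz_part _ _ _ _ _ _ f_emb 1).
    by rewrite expr1n.
  move=> x; have [U xU [C HC]] := H x; exists U => //; exists C.
  move=> [a|b] y z /= E Uy Uz; last by exfalso; move: E; lra.
  exact: le_trans (coord_le_euclidean_dist _ _ _) (HC y z Uy Uz).
have minus : ~ locally_lipschitz (@pi_minus R p q \o f).
  move=> H; apply/nR/(@riemannian_of_lipschitz_part _ _ _ _ _ _ f_emb (-1)).
    by rewrite sqrrN expr1n.
  move=> x; have [U xU [C HC]] := H x; exists U => //; exists C.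
  move=> [a|b] y z /= E Uy Uz; first by exfalso; move: E; lra.
  exact: le_trans (coord_le_euclidean_dist _ _ _) (HC y z Uy Uz).
have trivial m (g : X -> 'rV[R]_m) : m = 0%N -> locally_lipschitz g.
  move=> m0 x; exists setT; first exact: filterT.
  exists 0 => y z _ _; rewrite mul0r /euclidean_dist big1 ?sqrtr0//.
  by move=> [j jm]; exfalso; rewrite m0 in jm.
split=> //.
  by rewrite lt0n; apply/eqP => p0; apply: plus; exact: trivial.
by rewrite lt0n; apply/eqP => q0; apply: minus; exact: trivial.
Qed.
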